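(* Let $\Omega\subset\mathbb{R}^N$ be a bounded open connected set, $F\in C(\Omega\times\mathbb{R}\times\mathcal{S}(N),\mathbb{R})$, and let $\Phi$ be either a Hausdorff continuous proper elliptic map on $\Omega$ (constrained case) or $\Phi(x)=\mathcal{J}:=\mathbb{R}\times\mathcal{S}(N)$ for all $x\in\Omega$ (unconstrained case). Let $\Theta(x):=\{(r,A)\in\Phi(x):F(x,r,A)\ge0\}$ and $\Gamma(x):=\{(r,A):F(x,r,A)=0\}$. Assume: (i) $F(x,r+s,A+P)\ge F(x,r,A)$ for all $x\in\Omega$, $(r,A)\in\Phi(x)$, $(s,P)\in\mathcal{Q}$; (ii) for every open $\Omega'\subset\subset\Omega$ and every $\eta>0$ there is $\delta=\delta(\eta,\Omega')>0$ with $F(y,r-\eta,A+\eta I)\ge F(x,r,A)$ for all $(r,A)\in\Phi(x)$ and all $x,y\in\Omega'$ with $|x-y|<\delta$; (iii) $\Gamma(x)\cap\Phi(x)\neq\emptyset$ for each $x\in\Omega$; (iv) $F(x,r,A)>0$ for each $x\in\Omega$ and each $(r,A)\in(\Theta(x))^\circ$. In the constrained case assume moreover (v) $\partial\Phi(x)\subset\{(r,A):F(x,r,A)\le0\}$ for each $x$, and in the unconstrained case assume (v') $\{(r,A)\in\mathcal J:F(x,r,A)<0\}\neq\emptyset$ for every $x\in\Omega$. Then $\Theta$ is a Hausdorff continuous proper elliptic map, $\partial\Theta(x)\subset\Gamma(x)$ for all $x\in\Omega$, and the comparison principle holds: if $u\in\mathrm{USC}(\overline\Omega)$ restricts to a $\Phi$-admissible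 viscosity subsolution of $F(x,u,D^2u)=0$ in $\Omega$, $v\in\mathrm{LSC}(\overline\Omega)$ restricts to a $\Phi$-admissible viscosity supersolution of the same equation in $\Omega$, and $u\le v$ on $\partial\Omega$, then $u\le v$ in $\Omega$.
   Context: $\mathcal{S}(N)$: real symmetric $N\times N$ matrices with usual partial order, eigenvalues $\lambda_i(A)$, identity $I$. $\mathcal{Q}:=\{(s,P): s\le0,\ P\ge0\}$. A proper elliptic map assigns to each $x\in\Omega$ a closed, nonempty set $\subsetneq\mathbb{R}\times\mathcal{S}(N)$ invariant under adding elements of $\mathcal Q$. Hausdorff continuity: with norm $\|(r,A)\|=\max\{|r|,\max_i|\lambda_i(A)|\}$ and the induced Hausdorff distance $d_{\mathcal H}$ on closed subsets (possibly $+\infty$), for all $x\in\Omega$, $\eta>0$ there is $\delta>0$ with $d_{\mathcal H}(\Theta(x),\Theta(y))<\eta$ for $y\in\Omega$, $|x-y|<\delta$. $J^+_{x_0}u:=\{(\varphi(x_0),D^2\varphi(x_0)):\varphi$ is $C^2$ near $x_0$, $u\le\varphi$ near $x_0$, $u(x_0)=\varphi(x_0)\}$, $J^-_{x_0}u$ likewise with $u\ge\varphi$. $u\in\mathrm{USC}(\Omega)$ is a $\Phi$-admissible viscosity subsolution if for all $x_0\in\Omega$ and $(r,A)\in J^+_{x_0}u$: $F(x_0,r,A)\ge0$ and $(r,A)\in\Phi(x_0)$. $v\in\mathrm{LSC}(\Omega)$ is a $\Phi$-admissible viscosity supersolution if for all $x_0$ and $(r,A)\in J^-_{x_0}v$: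 $F(x_0,r,A)\le0$ or $(r,A)\notin(\Phi(x_0))^\circ$. *)

(* Defs.v *)
(* R : realType, points of R^N are 'rV[R]_N,
   elements of R x S(N) are pairs (r, A) : R * 'M[R]_N with A symmetric. *)
From HB Require Import structures.
From mathcomp Require Import all_boot all_order all_algebra.
From mathcomp Require Import all_classical all_reals all_analysis.
Set Implicit Arguments. Unset Strict Implicit. Unset Printing Implicit Defensive.
Import Order.TTheory GRing.Theory Num.Theory.
Import numFieldNormedType.Exports.
Local Open Scope classical_set_scope.
Local Open Scope ring_scope.

Section Defs.
Variables (R : realType) (N : nat).

Definition eucl_dist (x y : 'rV[R]_N) : R :=
  Num.sqrt (\sum_(i < N) (x ord0 i - y ord0 i) ^+ 2).

Definition symmx (A : 'M[R]_N) : Prop := A^T = A.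
Definition Jsp : set (R * 'M[R]_N) := [set p | symmx p.2].

Definition psd (P : 'M[R]_N) : Prop :=
  symmx P /\ forall v : 'rV[R]_N, 0 <= (v *m P *m v^T) ord0 ord0.
Definition mxle (A B : 'M[R]_N) : Prop := psd (B - A).

Definition Qset : set (R * 'M[R]_N) := [set q | q.1 <= 0 /\ psd q.2].

Definition specnorm (A : 'M[R]_N) : R :=
  sup [set `|a| | a in [set a : R | eigenvalue A a]].

Definition jnorm (p : R * 'M[R]_N) : R := Num.max `|p.1| (specnorm p.2).
Definition jdist (p q : R * 'M[R]_N) : R := jnorm (p.1 - q.1, p.2 - q.2).

Definition jclosure (X : set (R * 'M[R]_N)) : set (R * 'M[R]_N) :=
  [set p | Jsp p /\ forall e : R, 0 < e -> exists q, X q /\ jdist p q < e].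
Definition jinterior (X : set (R * 'M[R]_N)) : set (R * 'M[R]_N) :=
  [set p | Jsp p /\ exists2 e : R, 0 < e &
             forall q, Jsp q -> jdist p q < e -> X q].
Definition jboundary (X : set (R * 'M[R]_N)) : set (R * 'M[R]_N) :=
  jclosure X `\` jinterior X.
Definition jclosed (X : set (R * 'M[R]_N)) : Prop := jclosure X `<=` X.

Definition setdist (p : R * 'M[R]_N) (Y : set (R * 'M[R]_N)) : \bar R :=
  ereal_inf [set (jdist p q)%:E | q in Y].
Definition hausdorff (X Y : set (R * 'M[R]_N)) : \bar R :=
  Order.max (ereal_sup [set setdist p Y | p in X])
            (ereal_sup [set setdist q X | q in Y]).

Definition jadd (p q : R * 'M[R]_N) : R * 'M[R]_N := (p.1 + q.1, p.2 + q.2).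

Definition proper_elliptic (Om : set 'rV[R]_N)
    (Phi : 'rV[R]_N -> set (R * 'M[R]_N)) : Prop :=
  forall x, Om x ->
    [/\ Phi x `<=` Jsp, jclosed (Phi x), Phi x !=set0, Phi x != Jsp &
        forall p q, Phi x p -> Qset q -> Phi x (jadd p q)].

Definition hausdorff_continuous (Om : set 'rV[R]_N)
    (Phi : 'rV[R]_N -> set (R * 'M[R]_N)) : Prop :=
  forall x, Om x -> forall eta : R, 0 < eta ->
    exists2 delta : R, 0 < delta &
      forall y, Om y -> eucl_dist x y < delta ->
        (hausdorff (Phi x) (Phi y) < eta%:E)%E.

Definition F_continuous (Om : set 'rV[R]_N)
    (F : 'rV[R]_N -> R -> 'M[R]_N -> R) : Prop :=
  forall x r A, Om x -> symmx A -> forall e : R, 0 < e ->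
    exists2 d : R, 0 < d & forall y s B, Om y -> symmx B ->
      eucl_dist x y < d -> `|r - s| < d -> specnorm (A - B) < d ->
      `|F x r A - F y s B| < e.

Definition usc_on (S : set 'rV[R]_N) (u : 'rV[R]_N -> R) : Prop :=
  forall x, S x -> forall e : R, 0 < e -> exists2 d : R, 0 < d &
    forall y, S y -> eucl_dist x y < d -> u y < u x + e.
Definition lsc_on (S : set 'rV[R]_N) (u : 'rV[R]_N -> R) : Prop :=
  forall x, S x -> forall e : R, 0 < e -> exists2 d : R, 0 < d &
    forall y, S y -> eucl_dist x y < d -> u x - e < u y.

Definition evec (i : 'I_N) : 'rV[R]_N := delta_mx ord0 i.
Definition partial (i : 'I_N) (f : 'rV[R]_N -> R) : 'rV[R]_N -> R :=
  fun x => derive f x (evec i).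

Definition ball_e (x0 : 'rV[R]_N) (rho : R) : set 'rV[R]_N :=
  [set y | eucl_dist x0 y < rho].

Definition C2_on (U : set 'rV[R]_N) (phi : 'rV[R]_N -> R) : Prop :=
  [/\ forall x i, U x -> derivable phi x (evec i),
      forall x i j, U x -> derivable (partial j phi) x (evec i),
      forall x, U x -> {for x, continuous phi},
      forall x j, U x -> {for x, continuous (partial j phi)} &
      forall x i j, U x -> {for x, continuous (partial i (partial j phi))}].

Definition hessian (phi : 'rV[R]_N -> R) (x : 'rV[R]_N) : 'M[R]_N :=
  \matrix_(i, j) partial i (partial j phi) x.

Definition superjet (Om : set 'rV[R]_N) (u : 'rV[R]_N -> R) (x0 : 'rV[R]_N)
    : set (R * 'M[R]_N) :=
  [set p | exists phi : 'rV[R]_N -> R, exists2 rho : R, 0 < rho &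
     [/\ C2_on (ball_e x0 rho) phi,
         forall y, Om y -> eucl_dist x0 y < rho -> u y <= phi y,
         u x0 = phi x0 & p = (phi x0, hessian phi x0)]].
Definition subjet (Om : set 'rV[R]_N) (u : 'rV[R]_N -> R) (x0 : 'rV[R]_N)
    : set (R * 'M[R]_N) :=
  [set p | exists phi : 'rV[R]_N -> R, exists2 rho : R, 0 < rho &
     [/\ C2_on (ball_e x0 rho) phi,
         forall y, Om y -> eucl_dist x0 y < rho -> phi y <= u y,
         u x0 = phi x0 & p = (phi x0, hessian phi x0)]].

Definition admissible_subsolution (Om : set 'rV[R]_N)
    (F : 'rV[R]_N -> R -> 'M[R]_N -> R) (Phi : 'rV[R]_N -> set (R * 'M[R]_N))
    (u : 'rV[R]_N -> R) : Prop :=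
  usc_on Om u /\
  forall x0, Om x0 -> forall p, superjet Om u x0 p ->
    0 <= F x0 p.1 p.2 /\ Phi x0 p.

Definition admissible_supersolution (Om : set 'rV[R]_N)
    (F : 'rV[R]_N -> R -> 'M[R]_N -> R) (Phi : 'rV[R]_N -> set (R * 'M[R]_N))
    (v : 'rV[R]_N -> R) : Prop :=
  lsc_on Om v /\
  forall x0, Om x0 -> forall p, subjet Om v x0 p ->
    F x0 p.1 p.2 <= 0 \/ ~ jinterior (Phi x0) p.

Definition Theta (F : 'rV[R]_N -> R -> 'M[R]_N -> R)
    (Phi : 'rV[R]_N -> set (R * 'M[R]_N)) (x : 'rV[R]_N) : set (R * 'M[R]_N) :=
  [set p | Phi x p /\ 0 <= F x p.1 p.2].
Definition Gamma (F : 'rV[R]_N -> R -> 'M[R]_N -> R) (x : 'rV[R]_N)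
    : set (R * 'M[R]_N) :=
  [set p | Jsp p /\ F x p.1 p.2 = 0].

End Defs.

(* Main.v *)
(** Comparison is reduced, by doubling variables through sup-convolutions, to
    the following statement: if f and g are semiconvex and f + g - p has an
    interior maximum for all small slopes p, then f and g are touched from
    above, at points as close as desired, by paraboloids with Hessians X and Y
    such that X + Y <= delta I for any given delta > 0.  Adding
    del (|x|^2 - B) to u makes the subsolution property strict, so these jets
    put (v, -Y) in the interior of Theta, which a supersolution forbids.

    The statement on f and g replaces the theorems of Alexandrov and Jensen by
    a counting argument on a fine lattice.  Lattice maximizers of f + g - p for
    slopes p that are more than 2 lam apart in some coordinate are distinct, so
    a positive fraction of all lattice points are such contact points.  On the
    other hand, the second difference of f at scale 2^(k+1) is a 1/4, 1/2, 1/4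
    average of second differences at scale 2^k, so the sum over the lattice of
    the reciprocals of (shifted) second differences is monotone in k.  As this
    sum is bounded, at most scales and near most lattice points the second
    differences hardly vary along lines, that is, the third differences are
    small.  Hence there is a contact point around which f and g are uniformly
    close, at some scale, to quadratic polynomials, whose Hessians have a sum
    that is almost nonpositive; sliding these paraboloids gives the touching
    points. *)
Require Import Defs.
From HB Require Import structures.
From mathcomp Require Import all_boot all_order all_algebra.
From mathcomp Require Import all_classical all_reals all_analysis.
From mathcomp Require Import ring lra zify.
Set Implicit Arguments. Unset Strict Implicit. Unset Printing Implicit Defensive.
Import Order.TTheory GRing.Theory Num.Theory.
Import numFieldNormedType.Exports.
Local Open Scope ring_scope.

(** * Sums over lattice boxes *)

Section BoxSum.
Variables (R : realFieldType) (N : nat).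
Implicit Types (j : 'rV[int]_N) (n : nat) (h : 'rV[int]_N -> R).

Definition lbox n j := forall i, `|j ord0 i| <= n%:Z.

(** The shift by [n] lets a finite type index the box, so that big operators apply to it. *)
Definition boxpt n (t : {ffun 'I_N -> 'I_(2 * n)%N.+1}) : 'rV[int]_N :=
  \row_i ((t i : nat)%:Z - n%:Z).

Definition boxsum n h : R := \sum_(t : {ffun 'I_N -> 'I_(2 * n)%N.+1}) h (boxpt t).

Lemma lboxD n m j k : lbox n j -> lbox m k -> lbox (n + m)%N (j + k).
Proof. by move=> hj hk i; rewrite mxE; move: (hj i) (hk i); move: (j _ _) (k _ _) => a b; lia. Qed.

Lemma lboxN n j : lbox n j -> lbox n (- j).
Proof. by move=> hj i; rewrite mxE normrN. Qed.

Lemma lboxW n m j : (n <= m)%N -> lbox n j -> lbox m j.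
Proof. by move=> nm hj i; move: (hj i); move: (j _ _) => a; lia. Qed.

Lemma lboxMn n m j : lbox n j -> lbox (m * n)%N (j *+ m).
Proof.
by move=> hj i; move: (hj i); rewrite mulmxnE normrMn; move: (j _ _) => a; nia.
Qed.

Lemma lbox_boxpt n (t : {ffun 'I_N -> 'I_(2 * n)%N.+1}) : lbox n (boxpt t).
Proof. by move=> i; rewrite mxE; have := ltn_ord (t i); lia. Qed.

Lemma boxpt_inj n : injective (@boxpt n).
Proof.
move=> s t /rowP st; apply/ffunP => i; apply/val_inj => /=.
by have := st i; rewrite !mxE; lia.
Qed.

Lemma boxptP n j : lbox n j -> exists t, j = boxpt (n := n) t.
Proof.
move=> hj; exists [ffun i => inord (absz (j ord0 i + n%:Z))].
apply/rowP => i; rewrite mxE ffunE inordK; move: (hj i); move: (j _ _) => a; lia.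
Qed.

(** Injectivity counts each lattice point at most once, and nonnegativity allows the remaining ones
    to be dropped. Translating a box, enlarging it and the pigeonhole count are all instances. *)
Lemma boxsum_ge_inj (T : finType) n h (iota : T -> 'rV[int]_N) :
  injective iota -> (forall t, lbox n (iota t)) -> (forall j, 0 <= h j) ->
  \sum_(t : T) h (iota t) <= boxsum n h.
Proof.
move=> inji hi h0.
have [c hc] : exists c : T -> {ffun 'I_N -> 'I_(2 * n)%N.+1}, forall t, iota t = boxpt (c t).
  exists (fun t => [ffun i => inord (absz (iota t ord0 i + n%:Z))]) => t.
  apply/rowP => i; rewrite mxE ffunE inordK; move: (hi t i); move: (iota _ _ _) => a; lia.
have injc : injective c by move=> s t st; apply: inji; rewrite !hc st.
under eq_bigr => t _ do rewrite hc.
have -> : \sum_(t : T) h (boxpt (c t)) = \sum_(s in [set c t | t in T]) h (boxpt s).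
  by rewrite big_imset //=; move=> x y _ _; apply: injc.
rewrite /boxsum [leRHS](bigID [pred s | s \in [set c t | t in T]]) /=.
by rewrite lerDl; apply: sumr_ge0.
Qed.

Lemma boxsum_shift n m h s : lbox m s -> (forall j, 0 <= h j) ->
  boxsum n (fun j => h (j + s)) <= boxsum (n + m)%N h.
Proof.
move=> hs h0; apply: (boxsum_ge_inj (iota := fun t => boxpt t + s)) => //.
- by move=> t t' /addIr /boxpt_inj.
- by move=> t; apply: lboxD => //; apply: lbox_boxpt.
Qed.

Lemma boxsum_mono n m h : (n <= m)%N -> (forall j, 0 <= h j) ->
  boxsum n h <= boxsum m h.
Proof.
move=> nm h0; apply: boxsum_ge_inj => //; first exact: boxpt_inj.
by move=> t; apply: lboxW nm _; apply: lbox_boxpt.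
Qed.

Lemma boxsum_le1 n h : (forall j, h j <= 1) -> boxsum n h <= (2 * n + 1)%N%:R ^+ N.
Proof.
move=> h1; apply: le_trans (ler_sum _ (fun t _ => h1 _)) _.
by rewrite sumr_const card_ffun !card_ord addn1 -natrX.
Qed.

End BoxSum.

(** * The Jensen gap of the reciprocal *)

Section Drop.
Variable R : realFieldType.

(** Defect in Jensen's inequality for the convex function 1/t with weights 1/4, 1/2, 1/4. *)
Definition jensen_gap (p z m : R) : R :=
  p^-1 / 4 + z^-1 / 2 + m^-1 / 4 - (p / 4 + z / 2 + m / 4)^-1.

(** Expand 1/x = 1/c - (x - c)/c^2 + (x - c)^2/(x c^2) at the mean c: the linear terms average out
    and only the weighted remainders are left. *)
Lemma jensen_gapE (p z m : R) (c := p / 4 + z / 2 + m / 4) : 0 < p -> 0 < z -> 0 < m ->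
  jensen_gap p z m = (p - c) ^+ 2 / (4 * p * c ^+ 2) + (z - c) ^+ 2 / (2 * z * c ^+ 2)
     + (m - c) ^+ 2 / (4 * m * c ^+ 2).
Proof.
move=> p0 z0 m0; have c0 : 0 < c by rewrite /c; lra.
rewrite /jensen_gap -/c.
(* Eliminating [m] instead of [c] makes all denominators monomials for [field]. *)
have em : m = 4 * c - p - 2 * z by rewrite /c; lra.
clearbody c; rewrite {m}em in m0 *; field.
by rewrite !lt0r_neq0.
Qed.

Lemma jensen_gap_ge0 (p z m : R) : 0 < p -> 0 < z -> 0 < m -> 0 <= jensen_gap p z m.
Proof.
move=> p0 z0 m0; rewrite jensen_gapE //.
set c := p / 4 + z / 2 + m / 4; have c0 : 0 < c by rewrite /c; lra.
by rewrite !addr_ge0 // divr_ge0 ?sqr_ge0 // ?mulr_ge0 ?exprn_ge0 ?ltW.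
Qed.

(** On [1, L] the remainders of [p] and [z] in [jensen_gapE] are at least (p - c)^2/(4 L^3) and (z -
    c)^2/(4 L^3), and (p - c)^2 + (z - c)^2 >= (p - z)^2/2. *)
Lemma jensen_gap_small (p z m L tau : R) : 1 <= p <= L -> 1 <= z <= L -> 1 <= m <= L ->
  0 < tau -> jensen_gap p z m < tau ^+ 2 / (8 * L ^+ 3) -> `|p - z| < tau.
Proof.
move=> /andP[p1 pL] /andP[z1 zL] /andP[m1 mL] t0.
have p0 : 0 < p by lra. have z0 : 0 < z by lra. have m0 : 0 < m by lra.
have L0 : 0 < L by lra.
rewrite jensen_gapE //; set c := p / 4 + z / 2 + m / 4; have c0 : 0 < c by rewrite /c; lra.
have cL : c <= L by rewrite /c; lra.
have key : forall a x : R, 1 <= a -> a <= L -> x ^+ 2 / (4 * L ^+ 3) <= x ^+ 2 / (4 * a * c ^+ 2).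
  move=> a x a1 aL; rewrite ler_wpM2l ?sqr_ge0 // lef_pV2 ?posrE; last 2 first.
  - by rewrite ?mulr_gt0 ?exprn_gt0.
  - by rewrite ?mulr_gt0 ?exprn_gt0 //; lra.
  have -> : 4 * L ^+ 3 = 4 * L * L ^+ 2 by ring.
  apply: ler_pM; [lra | exact: sqr_ge0 | lra |].
  by rewrite lerXn2r ?nnegrE; lra.
move=> H; rewrite ltNge; apply/negP => tpz.
have h1 := key p (p - c) p1 pL.
have h2 : (z - c) ^+ 2 / (4 * L ^+ 3) <= (z - c) ^+ 2 / (2 * z * c ^+ 2).
  apply: le_trans (key z (z - c) z1 zL) _; rewrite ler_wpM2l ?sqr_ge0 //.
  by rewrite lef_pV2 ?posrE ?mulr_gt0 ?exprn_gt0 // ler_wpM2r ?exprn_ge0 ?ltW //; lra.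
have h3 : 0 <= (m - c) ^+ 2 / (4 * m * c ^+ 2).
  by rewrite divr_ge0 ?sqr_ge0 // ?mulr_ge0 ?exprn_ge0 ?ltW.
have h4 : tau ^+ 2 / (8 * L ^+ 3) <= (p - c) ^+ 2 / (4 * L ^+ 3) + (z - c) ^+ 2 / (4 * L ^+ 3).
  have -> : 8 * L ^+ 3 = 2 * (4 * L ^+ 3) by ring.
  rewrite invfM mulrA -mulrDl ler_wpM2r ?invr_ge0 ?mulr_ge0 ?exprn_ge0 ?(ltW L0) //.
  have : tau ^+ 2 <= (p - z) ^+ 2.
    by rewrite -[leRHS]real_normK ?num_real //; apply: lerXn2r => //; rewrite nnegrE ?normr_ge0 //; lra.
  have : 0 <= (p + z - 2 * c) ^+ 2 by apply: sqr_ge0.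
  by nra.
lra.
Qed.
End Drop.

(** * Energy across dyadic scales *)

Lemma four_pow (R : realFieldType) k : (2 ^ k)%:R ^+ 2 = 4 ^+ k :> R.
Proof. by rewrite natrX -exprM mulnC exprM -natrX. Qed.

Section Energy.
Variables (R : realFieldType) (N : nat).
Local Notation lat := 'rV[int]_N.

Definition zsq (j : lat) : R := \sum_i (j ord0 i)%:~R ^+ 2.

Definition sdiff (phi : lat -> R) (s x : lat) : R := phi (x + s) + phi (x - s) - 2 * phi x.

Definition lat_semicvx (lam : R) (phi : lat -> R) :=
  forall x s, - (lam * zsq s) <= sdiff phi s x.

Lemma zsq_ge0 j : 0 <= zsq j.
Proof. by apply: sumr_ge0 => i _; apply: sqr_ge0. Qed.

Lemma zsqMn j k : zsq (j *+ k) = k%:R ^+ 2 * zsq j.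
Proof.
rewrite /zsq mulr_sumr; apply: eq_bigr => i _.
by rewrite mulmxnE rmorphMn /= -mulr_natl exprMn.
Qed.

(* Shifted by 1 + lam |d|^2, so that semiconvexity makes it at least 1. *)
Definition acur (lam : R) (phi : lat -> R) (d : lat) (k : nat) (x : lat) : R :=
  1 + lam * zsq d + sdiff phi (d *+ 2 ^ k) x / 4 ^+ k.

(** What the averaged reciprocal of [acur] loses at x in passing from scale k to k+1, see
    [dropkE]. *)
Definition dropk lam phi d k x : R :=
  jensen_gap (acur lam phi d k (x + d *+ 2 ^ k)) (acur lam phi d k x)
        (acur lam phi d k (x - d *+ 2 ^ k)).

Variables (lam : R) (phi : lat -> R) (d : lat).
Hypothesis phicvx : lat_semicvx lam phi.

Lemma acur_ge1 k x : 1 <= acur lam phi d k x.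
Proof.
rewrite /acur -addrA lerDl addrC -lerBlDr sub0r ler_pdivlMr ?exprn_gt0 //.
apply: le_trans (phicvx x (d *+ 2 ^ k)).
by rewrite zsqMn four_pow mulNr -mulrA (mulrC (zsq d)).
Qed.

Lemma acur_gt0 k x : 0 < acur lam phi d k x.
Proof. exact: lt_le_trans ltr01 (acur_ge1 k x). Qed.

(** The second difference with step 2s at x is the sum of those with step s at x + s, twice at x,
    and at x - s; the factor 4 in the normalization turns this into an average. *)
Lemma acurS k x (a := acur lam phi d k) (s := d *+ 2 ^ k) :
  acur lam phi d k.+1 x = a (x + s) / 4 + a x / 2 + a (x - s) / 4.
Proof.
rewrite /a /acur /sdiff expnS mul2n -addnn mulrnDr -/s exprS !addrK !opprD !addrA.
rewrite !subrK.
by field; rewrite ?expf_neq0 ?pnatr_eq0 ?andbT.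
Qed.

Lemma dropk_ge0 k x : 0 <= dropk lam phi d k x.
Proof. by apply: jensen_gap_ge0; apply: acur_gt0. Qed.

Lemma dropkE k x (psi := fun k x => (acur lam phi d k x)^-1) :
  dropk lam phi d k x + psi k.+1 x =
  psi k (x + d *+ 2 ^ k) / 4 + psi k x / 2 + psi k (x - d *+ 2 ^ k) / 4.
Proof. by rewrite /dropk /jensen_gap /psi acurS subrK. Qed.

Lemma energy_step D k r (psi := fun k x => (acur lam phi d k x)^-1) : lbox D d ->
  boxsum r (dropk lam phi d k) + boxsum r (psi k.+1) <= boxsum (r + D * 2 ^ k)%N (psi k).
Proof.
move=> hd.
have psi0 x : 0 <= psi k x by rewrite invr_ge0 ltW ?acur_gt0.
have hs : lbox (D * 2 ^ k)%N (d *+ 2 ^ k) by rewrite mulnC; apply: lboxMn.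
have h1 := boxsum_shift r hs psi0.
have h2 := boxsum_shift r (lboxN hs) psi0.
have h3 : boxsum r (psi k) <= boxsum (r + D * 2 ^ k)%N (psi k).
  by apply: boxsum_mono => //; apply: leq_addr.
rewrite [leLHS](_ : _ = boxsum r (fun x => psi k (x + d *+ 2 ^ k)) / 4 + boxsum r (psi k) / 2
  + boxsum r (fun x => psi k (x - d *+ 2 ^ k)) / 4); last first.
  rewrite /boxsum !mulr_suml -!big_split /=; apply: eq_bigr => t _; exact: dropkE.
lra.
Qed.

(** The drops telescope over the scales, and the initial reciprocals are at most 1 since [acur] is
    at least 1. Apart from the growth of the box, the bound does not depend on the number of
    scales. *)
Lemma energy D K r : lbox D d ->
  \sum_(k < K) boxsum r (dropk lam phi d k) <= (2 * (r + D * 2 ^ K) + 1)%N%:R ^+ N.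
Proof.
move=> hd.
pose psi k x := (acur lam phi d k x)^-1.
have psi0 k x : 0 <= psi k x by rewrite invr_ge0 ltW ?acur_gt0.
(* The radius is generalized: the last scale enlarges the box by D 2^K, the induction hypothesis by
   another D 2^K, and these add up to D 2^(K+1). *)
suff H : forall r, \sum_(k < K) boxsum r (dropk lam phi d k) + boxsum r (psi K)
   <= boxsum (r + D * 2 ^ K)%N (psi 0%N).
  apply: le_trans (boxsum_le1 _ (h := psi 0%N) _); last first.
    by move=> j; rewrite invf_le1 ?acur_gt0 ?acur_ge1.
  apply: le_trans (H r); rewrite lerDl; exact: sumr_ge0.
elim: K => [|K IH] {}r.
  by rewrite big_ord0 add0r; apply: boxsum_mono => //; apply: leq_addr.
rewrite big_ord_recr /= -addrA.
have h1 := energy_step K r hd.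
have h2 := IH (r + D * 2 ^ K)%N.
have h3 : \sum_(k < K) boxsum r (dropk lam phi d k) <=
   \sum_(k < K) boxsum (r + D * 2 ^ K)%N (dropk lam phi d k).
  apply: ler_sum => k _; apply: boxsum_mono; first exact: leq_addr.
  by move=> j; apply: dropk_ge0.
rewrite expnS mul2n -addnn mulnDr addnA.
apply: le_trans h2; apply: lerD => //.
Qed.

End Energy.

Section Pigeon.
Variables (R : realFieldType) (N : nat).
Local Notation lat := 'rV[int]_N.

(** Double counting: if every point [pt i] sees a drop of at least c nearby at every scale, the
    total is at least K c |I|, while [energy] bounds it for each function, direction and offset. *)
Lemma pigeonhole_scales (I T S : finType) (lam : R) (pt : I -> lat) (dir : T -> lat)
  (phi : S -> lat -> R) (r D m K : nat) (c : R) (B := (2 * (r + m * 2 ^ K + D * 2 ^ K) + 1)%N) :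
  injective pt -> (forall i, lbox r (pt i)) -> (forall t, lbox D (dir t)) ->
  (forall s, lat_semicvx lam (phi s)) -> 0 < c ->
  (forall i (k : 'I_K), exists s t j, lbox m j /\
     c <= dropk lam (phi s) (dir t) k (pt i + j *+ 2 ^ k)) ->
  K%:R * c * #|I|%:R <= #|S|%:R * #|T|%:R * (2 * m + 1)%N%:R ^+ N * B%:R ^+ N.
Proof.
move=> injpt hpt hd cvx c0 bad.
set r' := (r + m * 2 ^ K)%N.
pose dr s t (k : 'I_K) := dropk lam (phi s) (dir t) k.
have dr0 s t k x : 0 <= dr s t k x by apply: dropk_ge0.
have hk (k : 'I_K) : c * #|I|%:R <=
    \sum_(s : S) \sum_(t : T) \sum_(j : {ffun 'I_N -> 'I_(2 * m)%N.+1}) boxsum r' (dr s t k).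
  (* The choice of s, t, j depends on i, so it is replaced by the sum over all choices. With these
     fixed, translation by j 2^k keeps the points distinct. *)
  apply: (@le_trans _ _ (\sum_(i : I) \sum_(s : S) \sum_(t : T)
     \sum_(j : {ffun 'I_N -> 'I_(2 * m)%N.+1}) dr s t k (pt i + boxpt j *+ 2 ^ k))).
    rewrite mulr_natr -sumr_const; apply: ler_sum => i _.
    have [s [t [j [hj hc]]]] := bad i k.
    have [j' ej] := boxptP hj.
    rewrite (bigD1 s) //= (bigD1 t) //= (bigD1 j') //= -ej.
    apply: ler_wpDr; first by do 3!(apply: sumr_ge0 => ? _).
    apply: ler_wpDr; first by do 2!(apply: sumr_ge0 => ? _).
    by apply: ler_wpDr => //; apply: sumr_ge0.
  rewrite exchange_big; apply: ler_sum => s _ /=.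
  rewrite exchange_big; apply: ler_sum => t _ /=.
  rewrite exchange_big; apply: ler_sum => j _ /=.
  apply: (boxsum_ge_inj (iota := fun i => pt i + boxpt j *+ 2 ^ k)) => //.
  - by move=> a b /addIr /injpt.
  - move=> i; apply: lboxD => //.
    have /lboxW : (2 ^ k * m <= m * 2 ^ K)%N.
      by rewrite mulnC leq_mul2l leq_exp2l // ltnW ?orbT.
    by apply; apply: lboxMn; apply: lbox_boxpt.
apply: (@le_trans _ _ (\sum_(k < K) \sum_(s : S) \sum_(t : T)
     \sum_(j : {ffun 'I_N -> 'I_(2 * m)%N.+1}) boxsum r' (dr s t k))).
  rewrite -mulrA mulr_natl -{1}(card_ord K) -sumr_const.
  by apply: ler_sum => k _; apply: hk.
rewrite exchange_big /=.
apply: (@le_trans _ _ (\sum_(s : S) \sum_(t : T)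
     \sum_(j : {ffun 'I_N -> 'I_(2 * m)%N.+1}) B%:R ^+ N)).
  apply: ler_sum => s _; rewrite exchange_big; apply: ler_sum => t _ /=.
  rewrite exchange_big; apply: ler_sum => j _ /=.
  exact: energy.
rewrite !sumr_const card_ffun !card_ord addn1 -!mulrnA -[leLHS]mulr_natl !natrM natrX.
by rewrite le_eqVlt; apply/orP; left; apply/eqP; ring.
Qed.
End Pigeon.

(** * Lattice contact points *)

Section Dot.
Variables (R : realType) (N : nat).
Implicit Types (a b c : 'rV[R]_N) (x y j : 'rV[int]_N).

Definition dot a b : R := \sum_i a ord0 i * b ord0 i.
Definition zv j : 'rV[R]_N := map_mx intr j.

Lemma dotC a b : dot a b = dot b a.
Proof. by apply: eq_bigr => i _; rewrite mulrC. Qed.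
Lemma dotDl a b c : dot (a + b) c = dot a c + dot b c.
Proof. by rewrite -big_split; apply: eq_bigr => i _; rewrite mxE mulrDl. Qed.
Lemma dotZl k a b : dot (k *: a) b = k * dot a b.
Proof. by rewrite mulr_sumr; apply: eq_bigr => i _; rewrite mxE mulrA. Qed.
Lemma dotNl a b : dot (- a) b = - dot a b.
Proof. by rewrite -scaleN1r dotZl mulN1r. Qed.
Lemma dotBl a b c : dot (a - b) c = dot a c - dot b c.
Proof. by rewrite dotDl dotNl. Qed.
Lemma dotDr a b c : dot a (b + c) = dot a b + dot a c.
Proof. by rewrite dotC dotDl !(dotC a). Qed.
Lemma dotZr k a b : dot a (k *: b) = k * dot a b.
Proof. by rewrite dotC dotZl dotC. Qed.
Lemma dotNr a b : dot a (- b) = - dot a b.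
Proof. by rewrite dotC dotNl dotC. Qed.
Lemma dotBr a b c : dot a (b - c) = dot a b - dot a c.
Proof. by rewrite dotDr dotNr. Qed.
Lemma dot0l a : dot 0 a = 0.
Proof. by rewrite -(scale0r 0) dotZl mul0r. Qed.
Lemma dot0r a : dot a 0 = 0.
Proof. by rewrite dotC dot0l. Qed.

Lemma dot_ge0 a : 0 <= dot a a.
Proof. by apply: sumr_ge0 => i _; rewrite -expr2 sqr_ge0. Qed.

Lemma coord_sqr_le a i : a ord0 i ^+ 2 <= dot a a.
Proof.
rewrite /dot (bigD1 i) //= -expr2 lerDl.
by apply: sumr_ge0 => k _; rewrite -expr2 sqr_ge0.
Qed.

Lemma dot_eq0 a : dot a a = 0 -> a = 0.
Proof.
move=> e; apply/rowP => i; rewrite mxE; apply/eqP.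
by rewrite -sqrf_eq0 eq_le sqr_ge0 -[in X in X && _]e coord_sqr_le.
Qed.

Lemma coord_le_sqrt a i : `|a ord0 i| <= Num.sqrt (dot a a).
Proof. by rewrite -sqrtr_sqr ler_sqrt ?coord_sqr_le ?dot_ge0. Qed.

Lemma sum_le_const (F : 'I_N -> R) (k : R) : (forall i, F i <= k) -> \sum_i F i <= N%:R * k.
Proof.
by move=> hF; apply: le_trans (ler_sum _ (fun i _ => hF i)) _; rewrite sumr_const card_ord mulr_natl.
Qed.

Lemma zvD x y : zv (x + y) = zv x + zv y.
Proof. exact: map_mxD. Qed.
Lemma zvN x : zv (- x) = - zv x.
Proof. exact: map_mxN. Qed.
Lemma zvB x y : zv (x - y) = zv x - zv y.
Proof. exact: map_mxB. Qed.
Lemma zv0 : zv 0 = 0.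
Proof. exact: map_mx0. Qed.
Lemma zvMn x k : zv (x *+ k) = k%:R *: zv x.
Proof. by rewrite /zv raddfMn scaler_nat. Qed.

Lemma zsqE j : zsq R j = dot (zv j) (zv j).
Proof. by apply: eq_bigr => i _; rewrite mxE expr2. Qed.
Lemma zsqN j : zsq R (- j) = zsq R j.
Proof. by rewrite !zsqE zvN dotNl dotNr opprK. Qed.

Lemma dot_delta a i : dot a (zv (delta_mx ord0 i)) = a ord0 i.
Proof.
rewrite /dot (bigD1 i) //= big1 => [|k ki]; rewrite !mxE eqxx /=.
  by rewrite eqxx mulr1 addr0.
by rewrite (negbTE ki) mulr0.
Qed.

Lemma zsq_delta i : zsq R (delta_mx ord0 i : 'rV[int]_N) = 1.
Proof. by rewrite zsqE dot_delta !mxE !eqxx. Qed.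

Lemma zsq_lbox n j : lbox n j -> zsq R j <= N%:R * n%:R ^+ 2.
Proof.
move=> hj; apply: sum_le_const => i; rewrite -[leLHS]real_normK ?num_real //.
rewrite lerXn2r ?nnegrE // -intr_norm [leRHS]pmulrn.
by rewrite ler_int.
Qed.

Lemma lbox_delta i : lbox 1 (delta_mx ord0 i : 'rV[int]_N).
Proof. by move=> k; rewrite !mxE eqxx /=; case: eqP. Qed.

End Dot.

Section Contact.
Variables (R : realType) (N : nat).
Local Notation lat := 'rV[int]_N.
Variables (lam : R).
Hypothesis lam0 : 0 < lam.

Definition lsupp (phi : lat -> R) (x : lat) (a : 'rV[R]_N) :=
  forall y, phi x + dot a (zv R (y - x)) - lam / 2 * zsq R (y - x) <= phi y.

Definition lcontact n (w : lat -> R) (x : lat) (p : 'rV[R]_N) :=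
  forall y, lbox n y -> w y <= w x + dot p (zv R (y - x)).

Lemma lsupp_semicvx phi : (forall x, exists a, lsupp phi x a) -> lat_semicvx lam phi.
Proof.
move=> H x s; have [a ha] := H x.
have := ha (x + s); have := ha (x - s).
rewrite !(addrC x) !addrK zsqN zvN dotNr /sdiff !(addrC x); lra.
Qed.

(** The lower bound is the support of [phi]. For the upper one, subtract the support of [gam] from
    the contact plane of the sum; the resulting slope p - b differs from a by at most lam in each
    coordinate, as testing the neighbours of x shows. *)
Lemma lcontact_bound n phi gam x p a b :
  lsupp phi x a -> lsupp gam x b -> lcontact n (fun y => phi y + gam y) x p ->
  (forall i, lbox n (x + delta_mx ord0 i) /\ lbox n (x - delta_mx ord0 i)) ->
  forall y, lbox n y -> `|phi y - phi x - dot a (zv R (y - x))| <= 2 * lam * zsq R (y - x).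
Proof.
move=> ha hb hc hx y hy.
have hab i : `|p ord0 i - a ord0 i - b ord0 i| <= lam.
  have [h1 h2] := hx i.
  have := hc _ h1; have := hc _ h2; have := ha (x + delta_mx ord0 i).
  have := ha (x - delta_mx ord0 i); have := hb (x + delta_mx ord0 i).
  have := hb (x - delta_mx ord0 i).
  rewrite !(addrC x) !addrK !zsqN !zvN !dotNr !dot_delta !zsq_delta ler_norml.
  set d := delta_mx _ _.
  by move: (phi _) (phi _) (phi _) (gam _) (gam _) (gam _) => a1 a2 a3 a4 a5 a6; lra.
move: (ha y) (hb y) (hc y hy); set z := y - x => h4 h5 h6; clearbody z.
(* Integer coordinates satisfy |z_i| <= z_i^2, so the linear error is absorbed by the quadratic
   one. *)
have h3 : dot (p - a - b) (zv R z) <= lam * zsq R z.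
  rewrite /dot /zsq mulr_sumr; apply: ler_sum => i _; rewrite !mxE.
  apply: le_trans (ler_norm _) _; rewrite normrM; apply: ler_pM => //.
  rewrite -intr_norm -[leRHS]real_normK ?num_real // -intr_norm -rmorphXn /= ler_int.
  by move: (z _ _) => t; rewrite expr2; nia.
have := zsq_ge0 R z; move: h3; rewrite !dotBl.
by rewrite ler_norml; nra.
Qed.

(* The discrete substitute for the area formula in Jensen's lemma. *)
Lemma lcontact_slope n phi gam x p p' : lat_semicvx lam phi -> lat_semicvx lam gam ->
  (forall i, lbox n (x + delta_mx ord0 i) /\ lbox n (x - delta_mx ord0 i)) ->
  lcontact n (fun y => phi y + gam y) x p -> lcontact n (fun y => phi y + gam y) x p' ->
  forall i, p' ord0 i - p ord0 i <= 2 * lam.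
Proof.
move=> h1 h2 hx hp hp' i; have [b1 b2] := hx i.
have := hp _ b1; have := hp' _ b2.
have := h1 x (delta_mx ord0 i); have := h2 x (delta_mx ord0 i).
rewrite /sdiff !(addrC x) !addrK zvN dotNr !dot_delta zsq_delta.
by move: (phi _) (phi _) (phi _) (gam _) (gam _) (gam _) => a1 a2 a3 a4 a5 a6; lra.
Qed.

(** Supplies the upper bound that [jensen_gap_small] requires. The affine part cancels in the second
    difference, whose weights 1, 1, 2 turn the error 2 lam into 8 lam. *)
Lemma acur_le n (phi : lat -> R) (x : lat) a d D k L j : (forall y, lbox n y ->
    `|phi y - phi x - dot a (zv R (y - x))| <= 2 * lam * zsq R (y - x)) ->
  lbox D d -> lbox L j -> (forall l, lbox (L + D)%N l -> lbox n (x + l *+ 2 ^ k)) ->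
  acur lam phi d k (x + j *+ 2 ^ k) <=
    1 + lam * (N%:R * D%:R ^+ 2) + 8 * lam * (N%:R * (L + D)%N%:R ^+ 2).
Proof.
move=> hb hd hj hn; rewrite /acur; apply: lerD.
  by rewrite lerD2l ler_pM2l // zsq_lbox.
rewrite ler_pdivrMr ?exprn_gt0 //.
pose F l := phi (x + l *+ 2 ^ k).
have hF l : lbox (L + D)%N l -> `|F l - phi x - dot a (zv R (l *+ 2 ^ k))| <=
   2 * lam * (N%:R * (L + D)%N%:R ^+ 2) * 4 ^+ k.
  move=> hl; have := hb _ (hn _ hl); rewrite (addrC x) addrK (addrC _ x) => /le_trans; apply.
  rewrite zsqMn four_pow mulrCA [leRHS]mulrC ler_wpM2l ?exprn_ge0 //.
  by rewrite ler_wpM2l ?zsq_lbox // mulr_ge0 ?(ltW lam0).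
have -> : sdiff phi (d *+ 2 ^ k) (x + j *+ 2 ^ k) = F (j + d) + F (j - d) - 2 * F j.
  by rewrite /sdiff /F mulrnBl mulrnDl !addrA.
have := hF _ (lboxD hj hd); have := hF _ (lboxD hj (lboxN hd)).
have := hF _ (lboxW (leq_addr D L) hj).
rewrite mulrnBl mulrnDl zvB zvD !dotBr !dotDr !ler_norml.
move: (F _) (F _) (F _) => a1 a2 a3; lra.
Qed.

End Contact.

Lemma box_radius_le n h m z : (0 < n)%N -> (h + (m + 22) * z <= n)%N ->
  (2 * (h + m * z + 11 * z) + 1 <= 3 * n)%N.
Proof. by nia. Qed.

(** * Contact points with small third differences *)

Section Select.
Variables (R : realType) (N : nat).
Local Notation lat := 'rV[int]_N.
Local Notation dl i := (delta_mx ord0 i : lat).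

(* The directions needed in [djokovic]. *)
Definition dirT : finType := ('I_N * 'I_N * 'I_N * (bool * bool * bool))%type.

Definition dir (t : dirT) : lat :=
  dl t.1.1.1 *+ (6 * t.2.1.1) + dl t.1.1.2 *+ (3 * t.2.1.2) + dl t.1.2 *+ (2 * t.2.2).

Lemma lbox_dir t : lbox 11 (dir t).
Proof.
have h n (b : bool) i : lbox n (dl i *+ (n * b)).
  apply: lboxW (lboxMn _ (lbox_delta i)); case: b; lia.
exact: (lboxD (lboxD (h 6 _ _) (h 3 _ _)) (h 2 _ _)).
Qed.

(** Quadratic blow-up at x and scale 2^k with the affine part removed; it carries second differences
    at scale 2^k to those at scale 1. *)
Definition blow (phi : lat -> R) (x : lat) (a : 'rV[R]_N) (k : nat) (j : lat) : R :=
  (phi (x + j *+ 2 ^ k) - phi x - dot a (zv R (j *+ 2 ^ k))) / 4 ^+ k.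

Lemma sdiff_blow phi x a k d j :
  sdiff (blow phi x a k) d j = sdiff phi (d *+ 2 ^ k) (x + j *+ 2 ^ k) / 4 ^+ k.
Proof.
rewrite /sdiff /blow mulrnBl mulrnDl !addrA zvD zvB dotDr dotBr.
move: (phi _) (phi _) (phi _) (phi _) => a1 a2 a3 a4; ring.
Qed.

(** The second clause bounds third differences along the directions [dir t]. *)
Definition near_quad (lam tau : R) m (B : lat -> R) :=
  (forall j, lbox m j -> `|B j| <= 2 * lam * zsq R j) /\
  (forall t j, lbox m j -> `|sdiff B (dir t) (j + dir t) - sdiff B (dir t) j| <= tau).

(** A small drop forces neighbouring values of [acur] to be close, and its constant shift cancels in
    their difference. The margin 22 is 11 for the step to a neighbour plus 11 for the reach of its
    second difference. *)
Lemma drop_near_quad lam tau m n k phi x a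
  (Lam := 1 + lam * (N%:R * 11%:R ^+ 2) + 8 * lam * (N%:R * (m + 22)%N%:R ^+ 2)) :
  0 < lam -> 0 < tau -> lat_semicvx lam phi ->
  (forall y, lbox n y -> `|phi y - phi x - dot a (zv R (y - x))| <= 2 * lam * zsq R (y - x)) ->
  (forall l, lbox (m + 22) l -> lbox n (x + l *+ 2 ^ k)) ->
  (forall t j, lbox m j ->
     dropk lam phi (dir t) k (x + j *+ 2 ^ k) < tau ^+ 2 / (8 * Lam ^+ 3)) ->
  near_quad lam tau m (blow phi x a k).
Proof.
move=> lam0 tau0 cvx hq hn hd; split.
  move=> j hj; rewrite /blow normrM normfV [`|4 ^+ k|]ger0_norm ?exprn_ge0 //.
  rewrite ler_pdivrMr ?exprn_gt0 // -[leRHS]mulrA [zsq _ _ * _]mulrC -four_pow -zsqMn.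
  have := hq _ (hn _ (lboxW (leq_addr _ _) hj)).
  by rewrite (addrC x) addrK (addrC _ x).
move=> t j hj; rewrite !sdiff_blow.
have hA l : lbox (m + 11) l -> 1 <= acur lam phi (dir t) k (x + l *+ 2 ^ k) <= Lam.
  move=> hl; rewrite acur_ge1 //=; apply: le_trans (acur_le _ hq (lbox_dir t) hl _) _ => //.
    by rewrite -addnA.
  by rewrite -addnA.
have h1 := hA _ (lboxD hj (lbox_dir t)).
have h2 := hA _ (lboxD hj (lboxN (lbox_dir t))).
have h3 := hA _ (lboxW (leq_addr _ _) hj).
move: h1 h2; rewrite mulrnBl mulrnDl !addrA => h1 h2.
have := jensen_gap_small h1 h3 h2 tau0 (hd t j hj).
rewrite /acur opprD addrACA subrr add0r => /ltW; congr (_ <= _).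
Qed.

(** There are at least a constant times n^N distinct contact points. If each were bad at each scale
    below K, the pigeonhole bound, of order n^N with a constant independent of K, would fail. So K
    is fixed before n, and the scale 2^k stays bounded as n grows. *)
Lemma good_contact (lam theta tau : R) (m : nat) : 0 < lam -> 0 < theta -> 0 < tau ->
  exists K n0, forall n, (n0 <= n)%N -> forall phi gam : lat -> R,
  (forall x, exists a, lsupp lam phi x a) -> (forall x, exists a, lsupp lam gam x a) ->
  (forall p : 'rV[R]_N, (forall i, `|p ord0 i| <= theta * n%:R) ->
     exists x, lbox n./2 x /\ lcontact n (fun y => phi y + gam y) x p) ->
  exists x (p a b : 'rV[R]_N) k, [/\ (k < K)%N, forall i, `|p ord0 i| <= theta * n%:R,
    lbox n./2 x /\ lcontact n (fun y => phi y + gam y) x p,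
    near_quad lam tau m (blow phi x a k) /\ near_quad lam tau m (blow gam x b k) &
    exists q, forall j, lbox m j ->
      blow phi x a k j + blow gam x b k j <= dot q (zv R j)].
Proof.
move=> lam0 th0 tau0.
pose Lam := 1 + lam * (N%:R * 11%:R ^+ 2) + 8 * lam * (N%:R * (m + 22)%N%:R ^+ 2).
have Lam0 : 0 < Lam.
  have h1 : 0 <= lam * (N%:R * 11%:R ^+ 2) by rewrite !mulr_ge0 ?exprn_ge0 ?(ltW lam0).
  have h2 : 0 <= 8 * lam * (N%:R * (m + 22)%N%:R ^+ 2) by rewrite !mulr_ge0 ?exprn_ge0 ?(ltW lam0).
  by rewrite /Lam; lra.
pose c := tau ^+ 2 / (8 * Lam ^+ 3).
have c0 : 0 < c by rewrite divr_gt0 ?mulr_gt0 ?exprn_gt0.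
(* Slopes on a grid of mesh [s0] > 2 lam have distinct contact points, by [lcontact_slope]. *)
pose s0 := 2 * lam + 1.
have s00 : 0 < s0 by rewrite /s0; lra.
pose al := theta / s0.
have al0 : 0 < al by rewrite divr_gt0.
(* The factors count the two functions, the directions, the offsets, and, up to n^N, the points of a
   box of side at most 3n. *)
pose Q := #|{: bool}|%:R * #|dirT|%:R * (2 * m + 1)%N%:R ^+ N * 3%:R ^+ N : R.
have [K hK] : exists K : nat, Q / (c * al ^+ N) < K%:R.
  exists (Num.bound (Q / (c * al ^+ N))); apply: archi_boundP.
  by rewrite divr_ge0 //; [rewrite /Q !mulr_ge0 ?exprn_ge0 | rewrite mulr_ge0 ?exprn_ge0 ?ltW].
(* For such n, stencils of radius (m + 22) 2^K centred in the half box remain in the box of radius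
   n. *)
exists K, (2 * (m + 22) * 2 ^ K + 2)%N => n hn phi gam sphi sgam hct.
have n0 : (0 < n)%N by apply: leq_trans hn; rewrite addn2.
have hhalf : (n./2 + (m + 22) * 2 ^ K <= n)%N.
  move: hn; move: ((m + 22) * 2 ^ K)%N (mulnA 2 (m + 22) (2 ^ K))%N => z <-.
  by have := odd_double_half n; lia.
have hhalf1 : (n./2 + 1 <= n)%N by have := odd_double_half n; lia.
have cphi := lsupp_semicvx sphi; have cgam := lsupp_semicvx sgam.
have nearx x : lbox n./2 x -> forall i, lbox n (x + dl i) /\ lbox n (x - dl i).
  move=> hx i; split; apply: lboxW hhalf1 _; apply: lboxD => //; first exact: lbox_delta.
  apply: lboxN; exact: lbox_delta.
have inbox x k l : lbox n./2 x -> (k < K)%N -> lbox (m + 22) l -> lbox n (x + l *+ 2 ^ k).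
  move=> hx hk hl; apply: lboxW hhalf _; apply: lboxD => //.
  have /lboxW : (2 ^ k * (m + 22) <= (m + 22) * 2 ^ K)%N.
    by rewrite mulnC leq_mul2l leq_exp2l // ltnW ?orbT.
  by apply; apply: lboxMn.
pose M := Num.truncn (al * n%:R).
have hM : al * n%:R < M.+1%:R.
  exact: truncnS_gt.
have hM' : M%:R <= al * n%:R.
  by rewrite truncn_le mulr_ge0 // ltW.
pose I : finType := {ffun 'I_N -> 'I_(2 * M)%N.+1}.
pose sl (t : I) : 'rV[R]_N := s0 *: zv R (boxpt t).
have hsl t i : `|sl t ord0 i| <= theta * n%:R.
  rewrite !mxE normrM (gtr0_norm s00) mulrC -ler_pdivlMr // mulrAC -/al.
  apply: le_trans hM'; rewrite -intr_norm [leRHS]pmulrn ler_int.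
  by have := lbox_boxpt t i; rewrite mxE.
have [pt hpt] := choice (fun t => hct (sl t) (hsl t)).
have injpt : injective pt.
  move=> t t' e; have [hx h1] := hpt t; have [_ h2] := hpt t'; rewrite -e in h2.
  apply: boxpt_inj; apply/rowP => i.
  have e1 := lcontact_slope cphi cgam (nearx _ hx) h1 h2 i.
  have e2 := lcontact_slope cphi cgam (nearx _ hx) h2 h1 i.
  have es u : sl u ord0 i = s0 * (boxpt u ord0 i)%:~R by rewrite mxE [zv _ _ _ _]mxE.
  move: e1 e2; rewrite !es; move: (boxpt t _ _) (boxpt t' _ _) => z1 z2.
  rewrite -!mulrBr -!intrB => e1 e2.
  have key z : s0 * z%:~R <= 2 * lam -> z <= 0.
    move=> hz; rewrite leNgt; apply/negP; rewrite gtz0_ge1 -(ler_int R) => zz.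
    have : s0 * 1 <= s0 * z%:~R by rewrite ler_pM2l.
    by rewrite /s0 in hz *; lra.
  by apply/eqP; rewrite eq_le -[X in X && _]subr_le0 -[X in _ && X]subr_le0 !key.
apply: contrapT => bad.
have hc1 s : lat_semicvx lam (if s then phi else gam) by case: s.
have badk : forall i (k : 'I_K), exists s t j, lbox m j /\
    c <= dropk lam (if s then phi else gam) (dir t) k (pt i + j *+ 2 ^ k).
  move=> i k; apply: contrapT => nb; apply: bad.
  have [hx hc] := hpt i; have [a ha] := sphi (pt i); have [b hb] := sgam (pt i).
  have hq1 := lcontact_bound lam0 ha hb hc (nearx _ hx).
  have hc' : lcontact n (fun y => gam y + phi y) (pt i) (sl i).
    by move=> y hy; rewrite (addrC (gam y)) (addrC (gam _)); apply: hc.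
  have hq2 := lcontact_bound lam0 hb ha hc' (nearx _ hx).
  have inb l : lbox (m + 22) l -> lbox n (pt i + l *+ 2 ^ k) by apply: inbox.
  exists (pt i), (sl i), a, b, k; split => //.
    split; [apply: drop_near_quad hq1 _ _ | apply: drop_near_quad hq2 _ _] => //.
      move=> t j hj; rewrite ltNge; apply/negP => h; apply: nb.
      by exists true, t, j.
      move=> t j hj; rewrite ltNge; apply/negP => h; apply: nb.
      by exists false, t, j.
  (* The contact slope, minus the two slopes removed by the blow-ups, in blow-up units. *)
  exists ((2 ^ k)%:R / 4 ^+ k *: (sl i - a - b)) => j hj.
  have := hc _ (inb _ (lboxW (leq_addr _ _) hj)) => hcj.
  rewrite /blow -[leLHS]mulrDl ler_pdivrMr ?exprn_gt0 // dotZl mulrAC divfK ?expf_neq0 ?pnatr_eq0 //.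
  move: hcj; rewrite [_ - pt i]addrAC subrr add0r zvMn !dotZr !dotBl.
  by move: (phi _) (phi _) (gam _) (gam _) => a1 a2 a3 a4; lra.
have := pigeonhole_scales injpt (fun t => (hpt t).1) lbox_dir hc1 c0 badk.
set B := (2 * (_ + _) + 1)%N => H.
have hB : B%:R <= 3 * n%:R :> R.
  rewrite -natrM ler_nat; exact: (box_radius_le n0 hhalf).
have hI : (al * n%:R) ^+ N <= #|I|%:R.
  rewrite card_ffun !card_ord natrX; apply: lerXn2r; rewrite ?nnegrE ?ler0n //.
    by rewrite mulr_ge0 ?(ltW al0).
  by apply: le_trans (ltW hM) _; rewrite ler_nat ltnS leq_pmull.
have : K%:R * c * (al * n%:R) ^+ N <= Q * n%:R ^+ N.
  apply: le_trans (le_trans _ H) _.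
    by rewrite ler_wpM2l // mulr_ge0 // ltW.
  rewrite /Q -!mulrA ler_wpM2l // ler_wpM2l // ler_wpM2l ?exprn_ge0 //.
  by rewrite -exprMn lerXn2r ?nnegrE // mulr_ge0.
rewrite exprMn mulrA ler_pM2r ?exprn_gt0 ?ltr0n // leNgt => /negP; apply.
by rewrite -mulrA -ltr_pdivrMr // mulr_gt0 ?exprn_gt0.
Qed.
End Select.

(** * Small third differences force a quadratic *)

Section Quad.
Variables (R : realType) (N : nat).
Local Notation lat := 'rV[int]_N.
Local Notation dl i := (delta_mx ord0 i : lat).

Lemma dotE (u v : 'rV[R]_N) : (u *m v^T) ord0 ord0 = dot u v.
Proof. by rewrite mxE; apply: eq_bigr => i _; rewrite mxE. Qed.

Lemma dot_mul_sym (H : 'M[R]_N) (u v : 'rV[R]_N) : H^T = H -> dot (u *m H) v = dot (v *m H) u.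
Proof.
move=> sH; rewrite -!dotE.
have -> : u *m H *m v^T = (v *m H *m u^T)^T by rewrite !trmx_mul trmxK sH mulmxA.
by rewrite mxE.
Qed.

(** Walk from j to 0, each step decreasing some nonzero coordinate in absolute value. The path stays
    in the box and has at most N m steps. *)
Lemma lattice_path (r : lat -> R) m tau : 0 <= tau -> r 0 = 0 ->
  (forall i j, lbox m j -> lbox m (j + dl i) -> `|r (j + dl i) - r j| <= tau) ->
  forall j, lbox m j -> `|r j| <= (N * m)%N%:R * tau.
Proof.
move=> tau0 r0 hr.
have H : forall n j, lbox m j -> (\sum_i absz (j ord0 i) = n)%N -> `|r j| <= n%:R * tau.
  elim=> [|n IH] j hj hn.
    have -> : j = 0.
      apply/rowP => i; apply/eqP; rewrite mxE -absz_eq0 -leqn0.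
      by rewrite -[leqRHS]hn (bigD1 i) //= leq_addr.
    by rewrite r0 normr0 mul0r.
  have [i hi] : exists i, j ord0 i != 0.
    apply/existsP; rewrite -negb_forall; apply/negP => /forallP h.
    by move: hn; rewrite big1 // => i _; have /eqP -> := h i.
  pose s := sgz (j ord0 i).
  pose j' := j - s *: dl i.
  have ji k : j' ord0 k = if k == i then j ord0 i - s else j ord0 k.
    rewrite !mxE eqxx /= eq_sym; case: eqP => [->|_]; rewrite ?mulr1 //.
    by rewrite mulr0 subr0.
  have hj' : lbox m j'.
    move=> k; rewrite ji; case: eqP => // _; move: (hj i) hi; rewrite /s.
    by move: (j ord0 i) => z; case: (sgzP z); lia.
  have hn' : (\sum_k absz (j' ord0 k) = n)%N.
    apply/eqP; rewrite -eqSS -hn (bigD1 i) //= [X in _ == X](bigD1 i) //= ji eqxx.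
    rewrite (eq_bigr (fun k => absz (j ord0 k))) => [|k /negbTE ki]; last by rewrite ji ki.
    rewrite -addSn; apply/eqP; congr (_ + _)%N.
    by move: hi; rewrite /s; move: (j ord0 i) => z; case: (sgzP z); lia.
  have h1 := IH _ hj' hn'.
  have h2 : `|r j - r j'| <= tau.
    move: hi; rewrite -sgz_eq0 -/s /j'; move: (hj'); rewrite /j'.
    rewrite /s; case: (sgzP (j ord0 i)) => //= _ hb _; rewrite ?scale1r ?scaleN1r ?opprK in hb *.
      by have := hr i _ hb; rewrite subrK; apply.
    by rewrite distrC; apply: hr.
  rewrite -natr1 mulrDl mul1r.
  have -> : r j = r j' + (r j - r j') by rewrite addrC subrK.
  by apply: le_trans (ler_normD _ _) _; apply: lerD.
move=> j hj; apply: le_trans (H _ j hj erefl) _.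
rewrite ler_wpM2r // ler_nat -[N in leqRHS](card_ord N) -sum_nat_const.
by apply: leq_sum => i _; have := hj i; move: (j _ _) => z; lia.
Qed.

Definition tdiff (f : lat -> R) (d z : lat) := sdiff f d (z + d) - sdiff f d z.

(* Djokovic's polarization: with directions divided by 1, 2 and 3, all the
   terms other than the vertices of the parallelepiped cancel in pairs. *)
Lemma djokovic (f : lat -> R) (x a b c : lat)
   (d := fun e : bool * bool * bool => a *+ (6 * e.1.1) + b *+ (3 * e.1.2) + c *+ (2 * e.2))
   (T := fun e => tdiff f (d e)
     (x + (a *+ (6 * e.1.1) + b *+ (6 * e.1.2) + c *+ (6 * e.2)) - d e *+ 2)) :
  f (x + a *+ 6 + b *+ 6 + c *+ 6) - f (x + a *+ 6 + b *+ 6) - f (x + a *+ 6 + c *+ 6)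
   - f (x + b *+ 6 + c *+ 6) + f (x + a *+ 6) + f (x + b *+ 6) + f (x + c *+ 6) - f x =
  T (true, false, false) + T (false, true, false) + T (false, false, true)
  - T (true, true, false) - T (true, false, true) - T (false, true, true)
  + T (true, true, true).
Proof.
pose g (p q r : int) := f (x + p *: a + q *: b + r *: c).
(* Of the four points z + 2d, z + d, z, z - d, the first is a vertex and the others do not depend on
   e1, e2 and e3 respectively; each of these three cancels in the alternating sum over its missing
   bit. *)
have TE e1 e2 e3 : T (e1, e2, e3) = g (6 * e1)%N (6 * e2)%N (6 * e3)%N - 3 * g 0 (3 * e2)%N (4 * e3)%N
     + 3 * g (- (6 * e1)%N%:Z) 0 (2 * e3)%N - g (- (12 * e1)%N%:Z) (- (3 * e2)%N%:Z) 0.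
  rewrite /T /tdiff /sdiff; set z := x + _ - _; set de := d _.
  have -> : f (z + de + de) = g (6 * e1)%N (6 * e2)%N (6 * e3)%N.
    by congr f; apply/rowP => l; rewrite /z /de /d /= !(mxE, mulmxnE);
       clear z de; case: e1 e2 e3 => [] [] [] /=; ring.
  have -> : f (z + de) = g 0 (3 * e2)%N (4 * e3)%N.
    by congr f; apply/rowP => l; rewrite /z /de /d /= !(mxE, mulmxnE);
       clear z de; case: e1 e2 e3 => [] [] [] /=; ring.
  have -> : f (z + de - de) = g (- (6 * e1)%N%:Z) 0 (2 * e3)%N.
    by congr f; apply/rowP => l; rewrite /z /de /d /= !(mxE, mulmxnE);
       clear z de; case: e1 e2 e3 => [] [] [] /=; ring.
  have -> : f z = g (- (6 * e1)%N%:Z) 0 (2 * e3)%N.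
    by congr f; apply/rowP => l; rewrite /z /de /d /= !(mxE, mulmxnE);
       clear z de; case: e1 e2 e3 => [] [] [] /=; ring.
  have -> : f (z - de) = g (- (12 * e1)%N%:Z) (- (3 * e2)%N%:Z) 0.
    by congr f; apply/rowP => l; rewrite /z /de /d /= !(mxE, mulmxnE);
       clear z de; case: e1 e2 e3 => [] [] [] /=; ring.
  ring.
rewrite !TE !muln1 !muln0 !oppr0.
have -> : f (x + a *+ 6 + b *+ 6 + c *+ 6) = g 6 6 6 by rewrite -!scaler_nat.
have -> : f (x + a *+ 6 + b *+ 6) = g 6 6 0 by rewrite /g scale0r addr0 -!scaler_nat.
have -> : f (x + a *+ 6 + c *+ 6) = g 6 0 6 by rewrite /g scale0r addr0 -!scaler_nat.
have -> : f (x + b *+ 6 + c *+ 6) = g 0 6 6 by rewrite /g scale0r addr0 -!scaler_nat.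
have -> : f (x + a *+ 6) = g 6 0 0 by rewrite /g !scale0r !addr0 -!scaler_nat.
have -> : f (x + b *+ 6) = g 0 6 0 by rewrite /g !scale0r !addr0 -!scaler_nat.
have -> : f (x + c *+ 6) = g 0 0 6 by rewrite /g !scale0r !addr0 -!scaler_nat.
have -> : f x = g 0 0 0 by rewrite /g !scale0r !addr0.
ring.
Qed.

(** Polarization controls mixed differences with step 6, hence the sublattice of mesh 6 with
    quadratic normalization. *)
Definition coarse (B : lat -> R) (j : lat) : R := B (j *+ 6) / 36.

(** Seven directional third differences divided by 36 sum to at most tau. The radius is 6m for the
    base point, 18 for the vertices and 22 for the shift by twice a direction. *)
Lemma coarse_third lam tau m B x i j k (C := coarse B) : near_quad lam tau (6 * m + 40) B ->
  lbox m x ->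
  `|C (x + dl i + dl j + dl k) - C (x + dl i + dl j) - C (x + dl i + dl k)
   - C (x + dl j + dl k) + C (x + dl i) + C (x + dl j) + C (x + dl k) - C x| <= tau.
Proof.
move=> [_ hB] hx.
have hT (e : bool * bool * bool) : `|tdiff B (dir (i, j, k, e)) (x *+ 6 + (dl i *+ (6 * e.1.1) +
    dl j *+ (6 * e.1.2) + dl k *+ (6 * e.2)) - dir (i, j, k, e) *+ 2)| <= tau.
  apply: hB; have h6 (b : bool) l : lbox 6 (dl l *+ (6 * b)).
    by apply: lboxW (lboxMn _ (lbox_delta l)); case: b; lia.
  have -> : (6 * m + 40 = 6 * m + (6 + 6 + 6) + 2 * 11)%N by lia.
  apply: lboxD; last by apply: lboxN; apply: lboxMn; apply: lbox_dir.
  by apply: lboxD; [apply: lboxMn | apply: lboxD; [apply: lboxD|]].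
have := djokovic B (x *+ 6) (dl i) (dl j) (dl k).
have := hT (true, false, false); have := hT (false, true, false).
have := hT (false, false, true); have := hT (true, true, false).
have := hT (true, false, true); have := hT (false, true, true).
have := hT (true, true, true).
rewrite /C /coarse !mulrnDl /dir /= !ler_norml.
set t1 := tdiff _ _ _; set t2 := tdiff _ _ _; set t3 := tdiff _ _ _; set t4 := tdiff _ _ _.
set t5 := tdiff _ _ _; set t6 := tdiff _ _ _; set t7 := tdiff _ _ _.
move: t1 t2 t3 t4 t5 t6 t7 => t1 t2 t3 t4 t5 t6 t7.
by move: (B _) (B _) (B _) (B _) (B _) (B _) (B _) (B _) => b1 b2 b3 b4 b5 b6 b7 b8; lra.
Qed.

(** Discrete Taylor expansion: [lattice_path] is applied to the remainders of the second
    differences, the first differences and the function, each time losing a factor N m. *)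
Lemma quad_approx lam tau m B : 0 < lam -> 0 <= tau -> near_quad lam tau (6 * m + 40) B ->
  exists (l : 'rV[R]_N) (H : 'M[R]_N), [/\ H^T = H, forall i j, `|H i j| <= 12 * lam &
    forall j, lbox m j ->
    `|coarse B j - dot l (zv R j) - dot (zv R j *m H) (zv R j) / 2| <= (N * m)%N%:R ^+ 3 * tau].
Proof.
move=> lam0 tau0 hB; pose C := coarse B.
pose D1 i x := C (x + dl i) - C x.
pose D2 i j x := C (x + dl i + dl j) - C (x + dl i) - C (x + dl j) + C x.
have C0 : C 0 = 0.
  have : `|B 0| <= 0.
    apply: le_trans (hB.1 0 _) _; first by move=> i; rewrite mxE.
    by rewrite zsqE zv0 dot0r mulr0.
  by rewrite normr_le0 => /eqP b0; rewrite /C /coarse mul0rn b0 mul0r.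
have hC j : lbox 2 j -> `|C j| <= 2 * lam * zsq R j.
  move=> hj; have : lbox (6 * m + 40) (j *+ 6).
    by apply: (@lboxW _ (6 * 2)); [lia | apply: lboxMn].
  move=> /hB.1; rewrite zsqMn /C /coarse normrM normfV => h.
  by rewrite [`|36|]ger0_norm // ler_pdivrMr //; apply: le_trans h _; lra.
pose H := \matrix_(i, j) D2 i j 0.
have D2C i j x : D2 i j x = D2 j i x by rewrite /D2 (addrAC x (dl i)); ring.
have sH : H^T = H by apply/matrixP => i j; rewrite !mxE D2C.
(* 2 lam (4 + 1 + 1), where the parallelogram identity bounds |e_i + e_j|^2 by 4. *)
have hH i j : `|H i j| <= 12 * lam.
  have z1 := zsq_delta R i; have z2 := zsq_delta R j.
  have z3 : zsq R (dl i + dl j) <= 4.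
    have : 0 <= zsq R (dl i - dl j) by apply: zsq_ge0.
    move: z1 z2; rewrite !zsqE !zvD !zvN !(dotDl, dotDr, dotNl, dotNr) (dotC (zv R (dl j)) (zv R (dl i))).
    by lra.
  have := hC _ (lboxD (lbox_delta i) (lbox_delta j)).
  have := hC _ (lboxW (isT : 1 <= 2)%N (lbox_delta i)).
  have := hC _ (lboxW (isT : 1 <= 2)%N (lbox_delta j)).
  rewrite mxE /D2 !add0r C0 z1 z2 !ler_norml.
  by move: (C _) (C _) (C _) => c1 c2 c3; nra.
(* A unit step in direction i adds H_ii/2 to the quadratic part, which the slope must compensate. *)
pose l := \row_i (D1 i 0 - H i i / 2).
exists l, H; split => //.
pose tau2 := (N * m)%N%:R * tau; pose tau1 := (N * m)%N%:R * tau2.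
have tau20 : 0 <= tau2 by rewrite mulr_ge0.
have tau10 : 0 <= tau1 by rewrite mulr_ge0.
have h2 i j x : lbox m x -> `|D2 i j x - H i j| <= tau2.
  apply: (lattice_path (r := fun x => D2 i j x - H i j)) => //; first by rewrite mxE subrr.
  move=> k y hy _; apply: le_trans (coarse_third i j k hB hy); rewrite le_eqVlt; apply/orP; left.
  apply/eqP; congr (`| _ |); rewrite /D2 /C.
  rewrite (addrAC y (dl k) (dl i)) (addrAC (y + dl i) (dl k) (dl j)) (addrAC y (dl k) (dl j)).
  by ring.
have eH k i : (zv R (dl k) *m H) ord0 i = H k i.
  by rewrite /zv map_delta_mx -rowE mxE.
have h1 i x : lbox m x -> `|D1 i x - D1 i 0 - (zv R x *m H) ord0 i| <= tau1.
  apply: (lattice_path (r := fun x => D1 i x - D1 i 0 - (zv R x *m H) ord0 i)) => //.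
    by rewrite zv0 mul0mx mxE !subrr.
  move=> k y hy _; apply: le_trans (h2 k i y hy); rewrite le_eqVlt; apply/orP; left.
  apply/eqP; congr (`| _ |); rewrite zvD mulmxDl [(zv R y *m H + _) ord0 i]mxE eH /D2 /D1.
  by ring.
have -> : (N * m)%N%:R ^+ 3 * tau = (N * m)%N%:R * tau1 by rewrite /tau1 /tau2; ring.
apply: (lattice_path (r := fun j => C j - dot l (zv R j) - dot (zv R j *m H) (zv R j) / 2)) => //.
  by rewrite zv0 !dot0r C0 mul0r !subr0.
move=> k y hy _; apply: le_trans (h1 k y hy); rewrite le_eqVlt; apply/orP; left.
apply/eqP; congr (`| _ |); rewrite zvD mulmxDl !dotDr !dotDl.
rewrite (dot_mul_sym (zv R (dl k)) (zv R y)) // !dot_delta eH [l _ _]mxE /D1.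
by field.
Qed.
End Quad.

Local Open Scope classical_set_scope.

(** * Touching paraboloids *)

(** Compactness is used twice: for an upper bound, so that the supremum is meaningful, and, if it
    were not attained, for a uniform gap below it. *)
Lemma usc_compact_max (R : realType) (T : topologicalType) (K : set T) (h : T -> R) :
  compact K -> K !=set0 ->
  (forall x, K x -> forall e, 0 < e -> \forall y \near x, K y -> h y < h x + e) ->
  exists2 x, K x & forall y, K y -> h y <= h x.
Proof.
move=> cK [k0 Kk0] usc; move/compact_near_coveringP : (cK) => ncK.
have [B hB] : exists B, forall y, K y -> h y <= B.
  have H1 x : K x -> \forall y \near x & i \near +oo, K y -> h y <= i.
    move=> Kx; exists ([set y | K y -> h y < h x + 1], [set i | h x + 1 < i]) => /=.
      by split; [exact: usc | apply: nbhs_pinfty_gt; rewrite num_real].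
    by move=> [y i] /= [h1 h2] Ky; apply: ltW; apply: lt_trans h2; apply: h1.
  have [M [_ hM]] := ncK _ _ (fun i y => K y -> h y <= i) _ H1; exists (M + 1) => y Ky.
    by apply: (hM (M + 1)) => //; rewrite ltrDl.
pose S := [set h x | x in K].
have hsS : has_sup S.
  split; first by exists (h k0), k0.
  by exists B => _ [x Kx <-]; exact: hB.
have ubS : ubound S (sup S) by exact: sup_upper_bound.
apply: contrapT => nomax.
have lt1 x : K x -> h x < sup S.
  move=> Kx; rewrite lt_neqAle ubS ?andbT; last by exists x.
  apply/eqP => e; apply: nomax; exists x => // y Ky; rewrite e.
  by apply: ubS; exists y.
have H2 x : K x -> \forall y \near x & i \near 0^'+, K y -> h y < sup S - i.
  move=> Kx; have := lt1 x Kx; rewrite -subr_gt0 => d0.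
  have d2 : 0 < (sup S - h x) / 2 by rewrite divr_gt0.
  exists ([set y | K y -> h y < h x + (sup S - h x) / 2], [set i | i < (sup S - h x) / 2]) => /=.
    by split; [exact: usc | apply: nbhs_right_lt].
  by move=> [y i] /= [h1 h2] Ky; have := h1 Ky; lra.
have [e /= e0 he] := ncK _ _ (fun i y => K y -> h y < sup S - i) _ H2.
  pose e1 := e / 2.
  have e10 : 0 < e1 by rewrite divr_gt0.
  have hh y : K y -> h y < sup S - e1.
    move=> Ky; apply: (he e1) => //=.
    by rewrite sub0r normrN gtr0_norm // /e1; lra.
  have [_ [y Ky <-] hy] := sup_adherent e10 hsS.
  by have := hh y Ky; lra.
Qed.

Section Touch.
Variables (R : realType) (N : nat).
Local Notation lat := 'rV[int]_N.
Implicit Types (u v y z : 'rV[R]_N) (H : 'M[R]_N).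

Definition semicvx (lam : R) (f : 'rV[R]_N -> R) :=
  forall z, exists a, forall y, f z + dot a (y - z) - lam / 2 * dot (y - z) (y - z) <= f y.

Lemma bil_bound H u v (p q h : R) : (forall i, `|u ord0 i| <= p) -> (forall i, `|v ord0 i| <= q) ->
  (forall i j, `|H i j| <= h) -> `|dot (u *m H) v| <= N%:R ^+ 2 * (p * q * h).
Proof.
move=> hu hv hH; rewrite /dot.
apply: le_trans (ler_norm_sum _ _ _) _.
rewrite expr2 -mulrA; apply: sum_le_const => i.
rewrite normrM mxE.
apply: (@le_trans _ _ (\sum_(j < N) `|u ord0 j * H j i| * `|v ord0 i|)).
  by rewrite -mulr_suml ler_wpM2r // ler_norm_sum.
apply: sum_le_const => j; rewrite normrM mulrAC.
by do 2!apply: ler_pM => //.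
Qed.

(* Rounding along the sign of a supporting slope bounds a semiconvex function
   off the lattice by its values on the lattice. *)
Lemma rounding (b y : 'rV[R]_N) m : (forall i, `|y ord0 i| <= m%:R) ->
  exists j : lat, [/\ lbox m j, 0 <= dot b (zv R j - y) &
     forall i, `|(zv R j - y) ord0 i| <= 1].
Proof.
move=> hy.
exists (\row_i (if 0 <= b ord0 i then Num.ceil (y ord0 i) else Num.floor (y ord0 i))).
have fl i := floor_itv (y ord0 i); have ce i := ceil_itv (y ord0 i).
split.
- move=> i; rewrite mxE ler_norml; have := hy i; rewrite ler_norml => /andP[h1 h2].
  case: ifP => _; apply/andP; split.
  + rewrite -(ler_int R) rmorphN /= -pmulrn; apply: le_trans h1 _.
    by have /andP[] := ce i.
  + by rewrite ceil_le_int -pmulrn.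
  + by rewrite floor_ge_int rmorphN /= -pmulrn.
  + rewrite -(ler_int R) -pmulrn; apply: le_trans h2.
    by have /andP[] := fl i.
- apply: sumr_ge0 => i _; rewrite !mxE; case: ifP => hb.
    by rewrite mulr_ge0 // subr_ge0; have /andP[] := ce i.
  rewrite mulr_le0 // ?subr_le0; last by have /andP[] := fl i.
  by move/negbT: hb; rewrite -ltNge => /ltW.
- move=> i; rewrite !mxE; case: ifP => _; rewrite ler_norml.
    by have := ce i; rewrite intrB; lra.
  by have := fl i; rewrite intrD; lra.
Qed.

End Touch.

Section Touch.
Variables (R : realType) (N : nat).
Local Notation lat := 'rV[int]_N.
Implicit Types (l u v y z d : 'rV[R]_N) (H : 'M[R]_N).

Definition quad l H v : R := dot l v + dot (v *m H) v / 2.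

Lemma quadD l H z d : H^T = H ->
  quad l H (z + d) = quad l H z + dot (l + z *m H) d + dot (d *m H) d / 2.
Proof.
move=> sH; rewrite /quad mulmxDl !dotDl !dotDr (dot_mul_sym d z sH); by field.
Qed.

Lemma continuous_sum_ord n (f : 'I_n -> 'rV[R]_N -> R) :
  (forall i, continuous (f i)) -> continuous (fun v => \sum_(i < n) f i v).
Proof.
by move=> cf; apply: continuous_big => [|i _]; [exact: add_continuous | exact: cf].
Qed.

Lemma continuous_dot (f g : 'rV[R]_N -> 'rV[R]_N) :
  (forall i, continuous (fun v => f v ord0 i)) -> (forall i, continuous (fun v => g v ord0 i)) ->
  continuous (fun v => dot (f v) (g v)).
Proof.
move=> cf cg; apply: continuous_sum_ord => i x.
by apply: continuousM; [apply: cf | apply: cg].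
Qed.

Lemma continuous_mulmx_coord H i : continuous (fun v => (v *m H) ord0 i).
Proof.
rewrite (_ : (fun _ => _) = (fun v => \sum_(j < N) v ord0 j * H j i)); last first.
  by apply/funext => v; rewrite mxE.
apply: continuous_sum_ord => j x; apply: continuousM; last exact: cst_continuous.
exact: coord_continuous.
Qed.

Lemma continuous_quad l H : continuous (quad l H).
Proof.
move=> x; apply: continuousD.
  apply: continuous_dot => i; first exact: cst_continuous.
  exact: coord_continuous.
apply: continuousM; last exact: cst_continuous.
apply: continuous_dot => i; first exact: continuous_mulmx_coord.
exact: coord_continuous.
Qed.

Lemma cube_compact (m : R) : compact [set v : 'rV[R]_N | forall i, `|v ord0 i| <= m].
Proof.
have := @rV_compact R N (fun=> `[- m, m]%classic) (fun=> @segment_compact R (- m) m).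
congr compact; apply/seteqP.
by split => v /= h i; have := h i; rewrite /= in_itv /= ler_norml.
Qed.

(** Maximize f minus the quadratic with Hessian H + kap I over the cube. The maximum is at least the
    value 0 at the origin, whereas on the boundary of the cube the term kap m^2/2 exceeds all
    errors. *)
Lemma touch_above (f : 'rV[R]_N -> R) (lam sig kap : R) m l H :
  0 < lam -> (0 < m)%N -> continuous f -> semicvx lam f ->
  H^T = H -> (forall i j, `|H i j| <= 12 * lam) -> f 0 = 0 ->
  (forall j : lat, lbox m j -> f (zv R j) <= quad l H (zv R j) + sig) ->
  sig + lam / 2 * N%:R + 6 * lam * N%:R ^+ 2 < kap / 2 * m%:R ^+ 2 -> 0 <= kap ->
  exists z l', (forall i, `|z ord0 i| < m%:R) /\
    forall y, (forall i, `|y ord0 i| <= m%:R) -> f y <= f z + quad l' (H + kap%:M) (y - z).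
Proof.
move=> lam0 m0 cf scf sH hH f0 hlat hnum kap0.
have sH' : (H + kap%:M)^T = H + kap%:M by rewrite linearD /= sH tr_scalar_mx.
pose h v := f v - quad l (H + kap%:M) v.
have [|x Kx e e0|z Kz hz] := @usc_compact_max R _ _ h (@cube_compact m%:R).
- by exists 0 => i /=; rewrite mxE normr0.
- have ch : {for x, continuous h} by apply: continuousB; [apply: cf | apply: continuous_quad].
  move/cvgrPdist_lt : ch => /(_ e e0); apply: filterS => y /= + _.
  by rewrite ltr_norml => /andP[+ _]; lra.
have Q0 : quad l (H + kap%:M) 0 = 0 by rewrite /quad !dot0r mul0r addr0.
have h0 : 0 <= h z.
  have -> : 0 = h 0 by rewrite /h Q0 f0 subr0.
  by apply: hz => i /=; rewrite mxE normr0.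
exists z, (l + z *m (H + kap%:M)); split => [i|y hy].
  rewrite ltNge; apply/negP => hi; move: h0; apply/negP; rewrite -ltNge.
  have [a ha] := scf z.
  (* Rounding along the difference of the two slopes at z gives the first-order terms a favourable
     sign. *)
  have [j [hj hb hd]] := rounding (a - l - z *m H) Kz.
  set d := zv R j - z in hb hd.
  have := ha (zv R j); rewrite -/d => h1.
  have h2 := hlat j hj.
  have ej : zv R j = z + d by rewrite /d addrC subrK.
  rewrite {2}ej quadD // in h2.
  have h3 : dot d d <= N%:R.
    rewrite -[leRHS]mulr1; apply: sum_le_const => k.
    by rewrite -expr2 -real_normK ?num_real // expr_le1.
  have h4 := bil_bound hd hd hH.
  have h5 : m%:R ^+ 2 <= dot z z.
    apply: le_trans (coord_sqr_le z i).
    by rewrite -[leRHS]real_normK ?num_real // lerXn2r ?nnegrE.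
  have h6 : quad l (H + kap%:M) z = quad l H z + kap / 2 * dot z z.
    by rewrite /quad mulmxDr mul_mx_scalar dotDl dotZl; field.
  rewrite /h h6; move: hb h2 h4; rewrite !dotBl dotDl ler_norml !mul1r => hb h2 /andP[_ h4].
  have h7 : lam / 2 * dot d d <= lam / 2 * N%:R by rewrite ler_pM2l // divr_gt0.
  have h8 : kap / 2 * m%:R ^+ 2 <= kap / 2 * dot z z by rewrite ler_wpM2l // divr_ge0.
  lra.
have := hz y hy; rewrite /h.
have {2}-> : y = z + (y - z) by rewrite addrC subrK.
by rewrite quadD // /quad; lra.
Qed.

(** Scale v to Euclidean length m and round it to the lattice; the two bilinear errors are at most
    N^2 m h each. *)
Lemma quad_lattice_le H (h s : R) m : (0 < m)%N -> H^T = H -> (forall i j, `|H i j| <= h) ->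
  (forall j : lat, lbox m j -> dot (zv R j *m H) (zv R j) <= s) ->
  forall v, dot (v *m H) v <= (s + 2 * N%:R ^+ 2 * m%:R * h) / m%:R ^+ 2 * dot v v.
Proof.
move=> m0 sH hH hs v.
have [/dot_eq0 ->|vpos] := eqVneq (dot v v) 0; first by rewrite !dot0r mulr0.
have {}vpos : 0 < dot v v by rewrite lt_def vpos dot_ge0.
pose r := Num.sqrt (dot v v).
have r0 : 0 < r by rewrite sqrtr_gt0.
have r2 : r ^+ 2 = dot v v by rewrite sqr_sqrtr ?dot_ge0.
have m0' : 0 < m%:R :> R by rewrite ltr0n.
pose t := (m%:R / r) *: v.
have ht i : `|t ord0 i| <= m%:R.
  have mr0 : 0 <= m%:R / r by rewrite divr_ge0 // ltW.
  rewrite mxE normrM (ger0_norm mr0) mulrAC ler_pdivrMr // ler_pM2l //.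
  exact: coord_le_sqrt.
have [j [hj _ he]] := rounding 0 ht.
have hj' i : `|zv R j ord0 i| <= m%:R.
  by rewrite mxE -intr_norm [leRHS]pmulrn ler_int.
have h1 := bil_bound he hj' hH.
have h2 := bil_bound ht he hH.
have h3 := hs j hj.
have h4 : dot (t *m H) t <= s + 2 * N%:R ^+ 2 * m%:R * h.
  have e : dot (t *m H) t = dot (zv R j *m H) (zv R j) - dot ((zv R j - t) *m H) (zv R j)
     - dot (t *m H) (zv R j - t).
    rewrite mulmxBl dotBl !dotBr; ring.
  move: h1 h2; rewrite e !ler_norml => /andP[h1 _] /andP[h2 _]; lra.
have h5 : dot (t *m H) t = m%:R ^+ 2 / dot v v * dot (v *m H) v.
  rewrite /t -scalemxAl dotZl dotZr -r2; field; exact: lt0r_neq0.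
rewrite mulrAC ler_pdivlMr ?exprn_gt0 // mulrC -ler_pdivrMr // mulrAC -h5.
by apply: le_trans h4 _; rewrite le_eqVlt eqxx.
Qed.

End Touch.

(** * From lattice contact points to touching paraboloids *)

Section Core.
Variables (R : realType) (N : nat).
Local Notation lat := 'rV[int]_N.
Implicit Types (f g : 'rV[R]_N -> R) (c x y z p : 'rV[R]_N).

(** Division by h^2 keeps the semiconvexity constant independent of the mesh. *)
Definition lattice_fun f c (h : R) (j : lat) : R := f (c + h *: zv R j) / h ^+ 2.

Lemma lattice_fun_supp f lam c h : 0 < h -> semicvx lam f ->
  forall x : lat, exists a, lsupp lam (lattice_fun f c h) x a.
Proof.
move=> h0 sf x; have [a ha] := sf (c + h *: zv R x).
exists (h^-1 *: a) => y; have := ha (c + h *: zv R y).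
rewrite opprD addrACA subrr add0r -scalerBr -zvB dotZr dotZl dotZl dotZr -zsqE => H.
have h2 : 0 < h ^+ 2 by rewrite exprn_gt0.
rewrite /lattice_fun ler_pdivlMr // mulrBl mulrDl divfK ?lt0r_neq0 //.
apply: le_trans H; rewrite le_eqVlt; apply/orP; left; apply/eqP; field.
exact: lt0r_neq0.
Qed.

Lemma lattice_max_exists (w : lat -> R) n :
  exists2 x : lat, lbox n x & forall y : lat, lbox n y -> w y <= w x.
Proof.
pose F (t : {ffun 'I_N -> 'I_(2 * n)%N.+1}) := w (boxpt t).
have [t _ ht] := @arg_maxP _ R _ [ffun=> ord0] xpredT F isT.
exists (boxpt t); first exact: lbox_boxpt.
by move=> y /boxptP[s ->]; apply: ht.
Qed.

Definition rescale f x (a : 'rV[R]_N) (eta : R) : 'rV[R]_N -> R :=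
  fun t => (f (x + eta *: t) - f x - eta * dot a t) / eta ^+ 2.

Lemma rescale_semicvx f lam x a eta : 0 < eta -> semicvx lam f -> semicvx lam (rescale f x a eta).
Proof.
move=> e0 sf z; have [a' ha] := sf (x + eta *: z).
exists (eta^-1 *: (a' - a)) => y; have := ha (x + eta *: y).
rewrite opprD addrACA subrr add0r -scalerBr !(dotZr, dotZl, dotBl, dotBr) => H.
have h2 : 0 < eta ^+ 2 by rewrite exprn_gt0.
rewrite /rescale ler_pdivlMr // mulrBl mulrDl divfK ?lt0r_neq0 //.
have e1 : eta != 0 by exact: lt0r_neq0.
rewrite -subr_ge0 in H; rewrite -subr_ge0; apply: le_trans H _.
rewrite le_eqVlt; apply/orP; left; apply/eqP; field => //.
Qed.

Lemma rescale_continuous f x a eta : continuous f -> continuous (rescale f x a eta).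
Proof.
move=> cf t; apply: (@continuousM R 'rV[R]_N
  (fun t : 'rV[R]_N => f (x + eta *: t) - f x - eta * dot a t) (fun=> (eta ^+ 2)^-1));
  last exact: cst_continuous.
apply: continuousB; last first.
  apply: continuousM; first exact: cst_continuous.
  apply: continuous_dot => i; [exact: cst_continuous | exact: coord_continuous].
apply: continuousB; last exact: cst_continuous.
apply: (@continuous_comp 'rV[R]_N 'rV[R]_N R (fun t => x + eta *: t) f); last exact: cf.
apply: (@continuousD R 'rV[R]_N 'rV[R]_N (fun=> x)); first exact: cst_continuous.
exact: scaler_continuous.
Qed.

Lemma rescale0 f x a eta : rescale f x a eta 0 = 0.
Proof. by rewrite /rescale scaler0 addr0 subrr dot0r mulr0 subrr mul0r. Qed.

(** The mesh h, the dyadic scale and the factor 6 combine into one continuous rescaling, to which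
    [touch_above] applies. *)
Lemma coarse_blowE f c h (x : lat) a k j : 0 < h ->
  coarse (blow (lattice_fun f c h) x a k) j =
  rescale f (c + h *: zv R x) (h *: a) (h * 6 * (2 ^ k)%:R) (zv R j).
Proof.
move=> h0; rewrite /coarse /blow /rescale /lattice_fun -four_pow.
have -> : c + h *: zv R (x + j *+ 6 *+ 2 ^ k) = c + h *: zv R x + (h * 6 * (2 ^ k)%:R) *: zv R j.
  by rewrite zvD !zvMn scalerDr addrA !scalerA; congr (_ + _ *: _); ring.
rewrite !zvMn dotZr dotZr dotZl.
by field; rewrite ?natrX ?expf_neq0 ?pnatr_eq0 ?expn_eq0 ?lt0r_neq0.
Qed.

(** The reciprocal of 1 plus the sum of the reciprocals also covers an empty index set. *)
Lemma pos_lower_bound n (F : 'I_n -> R) : (forall i, 0 < F i) ->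
  exists2 r, 0 < r & forall i, r <= F i.
Proof.
move=> F0; have S0 : 0 <= \sum_i (F i)^-1 by apply: sumr_ge0 => i _; rewrite invr_ge0 ltW.
exists (1 + \sum_i (F i)^-1)^-1; first by rewrite invr_gt0; lra.
move=> i; rewrite -[leRHS]invrK lef_pV2 ?posrE ?invr_gt0 //; last by lra.
rewrite (bigD1 i) //= addrCA lerDl addr_ge0 //.
by apply: sumr_ge0 => k _; rewrite invr_ge0 ltW.
Qed.

(** The slope stays existential because jets record only the value and the Hessian. *)
Definition touched f z (X : 'M[R]_N) := exists2 r, 0 < r & exists l, forall y,
  (forall i, `|(y - z) ord0 i| < r) -> f y <= f z + quad l X (y - z).

Lemma rescale_touched f x a eta z l X m : 0 < eta -> (forall i, `|z ord0 i| < m) ->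
  (forall y, (forall i, `|y ord0 i| <= m) ->
    rescale f x a eta y <= rescale f x a eta z + quad l X (y - z)) ->
  touched f (x + eta *: z) X.
Proof.
move=> e0 hz H.
have [|r r0 hr] := @pos_lower_bound N (fun i => m - `|z ord0 i|).
  by move=> i; rewrite subr_gt0.
have e1 : eta != 0 by exact: lt0r_neq0.
exists (eta * r); first by rewrite mulr_gt0.
exists (a + eta *: l) => y hy.
pose d := eta^-1 *: (y - (x + eta *: z)).
have ed : y = x + eta *: (z + d).
  by rewrite scalerDr scalerA divff // scale1r addrA addrC subrK.
have hd : forall i, `|(z + d) ord0 i| <= m.
  move=> i; rewrite mxE; apply: le_trans (ler_normD _ _) _.
  have : `|d ord0 i| <= r.
    rewrite mxE normrM gtr0_norm ?invr_gt0 // ler_pdivrMl //; exact/ltW/hy.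
  by have := hr i; lra.
have := H _ hd; have -> : z + d - z = d by rewrite addrAC subrr add0r.
rewrite /rescale -ed.
have -> : y - (x + eta *: z) = eta *: d by rewrite scalerA divff // scale1r.
rewrite ler_pdivrMr ?exprn_gt0 // mulrDl divfK ?expf_neq0 // dotDr.
rewrite /quad -!scalemxAl !(dotDl, dotZr, dotZl).
move: (f y) (f x) (f _) => f1 f2 f3; nra.
Qed.

End Core.

Lemma normz_le_half (z : int) (n : nat) : `|z| * 2 <= n%:Z -> `|z| <= n./2%:Z.
Proof. by have := odd_double_half n; lia. Qed.

Section Core.
Variables (R : realType) (N : nat).
Local Notation lat := 'rV[int]_N.
Implicit Types (f g : 'rV[R]_N -> R) (c : 'rV[R]_N).

Lemma near_quad_touched f lam tau m sig kap x a eta B :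
  0 < lam -> 0 < eta -> (0 < m)%N -> 0 <= tau -> 0 <= kap ->
  continuous f -> semicvx lam f ->
  near_quad lam tau (6 * m + 40) B ->
  (forall j : lat, coarse B j = rescale f x a eta (zv R j)) ->
  (N * m)%N%:R ^+ 3 * tau <= sig ->
  sig + lam / 2 * N%:R + 6 * lam * N%:R ^+ 2 < kap / 2 * m%:R ^+ 2 ->
  exists (l : 'rV[R]_N) (H : 'M[R]_N) (z : 'rV[R]_N), [/\ H^T = H, forall i j, `|H i j| <= 12 * lam,
     forall j : lat, lbox m j -> quad l H (zv R j) - sig <= coarse B j,
     forall i, `|z ord0 i| < m%:R & touched f (x + eta *: z) (H + kap%:M)].
Proof.
move=> lam0 eta0 m0 tau0 kap0 cf sf nq eB hsig hnum.
have [l [H [sH hH hq]]] := quad_approx lam0 tau0 nq.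
have hq1 (j : lat) : lbox m j -> `|coarse B j - quad l H (zv R j)| <= sig.
  by move=> hj; apply: le_trans hsig; apply: le_trans (hq j hj); rewrite /quad opprD addrA.
have hup (j : lat) : lbox m j -> rescale f x a eta (zv R j) <= quad l H (zv R j) + sig.
  by move=> hj; rewrite -eB; have := hq1 j hj; rewrite ler_norml; lra.
have [z [l' [hz ht]]] := touch_above lam0 m0 (@rescale_continuous _ _ f x a eta cf)
  (rescale_semicvx x a eta0 sf) sH hH (rescale0 f x a eta) hup hnum kap0.
exists l, H, z; split => //.
  by move=> j hj; have := hq1 j hj; rewrite ler_norml; lra.
exact: rescale_touched ht.
Qed.

(** Adding the inequalities at j and -j removes all linear terms. *)
Lemma lattice_hessian_le (H1 H2 : 'M[R]_N) (l1 l2 q : 'rV[R]_N) (B1 B2 : lat -> R) sig m :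
  H1^T = H1 -> H2^T = H2 ->
  (forall j : lat, lbox m j -> quad l1 H1 (zv R j) - sig <= B1 j) ->
  (forall j : lat, lbox m j -> quad l2 H2 (zv R j) - sig <= B2 j) ->
  (forall j : lat, lbox m j -> B1 j + B2 j <= dot q (zv R j)) ->
  forall j : lat, lbox m j -> dot (zv R j *m (H1 + H2)) (zv R j) <= 4 * sig.
Proof.
move=> s1 s2 h1 h2 h3 j hj.
have := h1 j hj; have := h2 j hj; have := h3 j hj.
have := h1 _ (lboxN hj); have := h2 _ (lboxN hj); have := h3 _ (lboxN hj).
rewrite /quad zvN !mulNmx !(dotNl, dotNr) mulmxDr dotDl; lra.
Qed.

(** The hypothesis on p keeps the maximizers for small slopes in the half cube. Parameters are
    chosen in the order m, tau, K, n, so that the mesh is refined only after the range of scales is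
    known. *)
Theorem touching_pair f g (lam b p0 : R) c : 0 < lam -> 0 < b -> 0 < p0 ->
  continuous f -> continuous g -> semicvx lam f -> semicvx lam g ->
  (forall p x : 'rV[R]_N, (forall i, `|p ord0 i| <= p0) -> (forall i, `|(x - c) ord0 i| <= b) ->
     f c + g c + dot p (x - c) <= f x + g x -> forall i, `|(x - c) ord0 i| <= b / 2) ->
  forall delta rho, 0 < delta -> 0 < rho ->
  exists (x p z1 z2 : 'rV[R]_N) (X Y : 'M[R]_N), [/\ forall i, `|p ord0 i| <= p0,
    (forall i, `|(x - c) ord0 i| <= b) /\ f c + g c + dot p (x - c) <= f x + g x,
    forall i, `|(z1 - x) ord0 i| <= rho /\ `|(z2 - x) ord0 i| <= rho,
    [/\ X^T = X, Y^T = Y, touched f z1 X & touched g z2 Y] &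
    forall v, dot (v *m (X + Y)) v <= delta * dot v v].
Proof.
move=> lam0 b0 p00 cf cg sf sg hint delta rho d0 rho0.
(* Dominates the errors of [lattice_hessian_le] and [quad_lattice_le], with sig = 1 and entries
   bounded by 24 lam, as well as those of [touch_above]. *)
pose T := 4 + 48 * lam * N%:R ^+ 2 + lam * N%:R.
have lN0 : 0 <= lam * N%:R by rewrite mulr_ge0 // ltW.
have lN20 : 0 <= lam * N%:R ^+ 2 by rewrite mulr_ge0 ?exprn_ge0 // ltW.
have T0 : 0 < T by rewrite /T -mulrA; lra.
pose m := (Num.truncn (8 * T / delta)).+1.
have hm : 8 * T / delta < m%:R by apply: truncnS_gt.
have m1 : 1 <= m%:R :> R by rewrite ler1n.
have m0 : (0 < m)%N by [].
have hTm : 8 * T < delta * m%:R by rewrite (mulrC delta) -ltr_pdivrMr.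
pose A : R := (N * m)%N%:R ^+ 3.
have A0 : 0 <= A by rewrite exprn_ge0.
pose tau := (A + 1)^-1.
have tau0 : 0 < tau by rewrite invr_gt0; lra.
have hsig : A * tau <= 1 by rewrite /tau ler_pdivrMr ?mul1r; lra.
(* The two slides contribute 2 kap = delta/2; the other half is left for H1 + H2. *)
pose kap := delta / 4.
have kap0 : 0 <= kap by rewrite divr_ge0 // ltW.
have mm : m%:R <= m%:R ^+ 2 :> R by rewrite expr2 ler_peMr // ler0n.
have hnum : 1 + lam / 2 * N%:R + 6 * lam * N%:R ^+ 2 < kap / 2 * m%:R ^+ 2.
  have h1 : delta * m%:R <= delta * m%:R ^+ 2 by rewrite ler_pM2l.
  rewrite /kap /T in h1 hTm *; rewrite -!mulrA in h1 hTm lN20 *; lra.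
pose theta := p0 / b.
have th0 : 0 < theta by rewrite divr_gt0.
have [K [n0 good]] := good_contact N (6 * m + 40) lam0 th0 tau0.
(* n >= E makes the largest rescaled cube, of half-side 6 h 2^K m, fit within rho. *)
pose E := (6 * 2 ^ K * m)%N%:R * b / rho.
pose n := (n0 + (Num.truncn E).+1)%N.
have n_gt0 : 0 < n%:R :> R by rewrite ltr0n /n addnS.
have hE : E <= n%:R.
  by apply: le_trans (ltW (truncnS_gt E)) _; rewrite ler_nat leq_addl.
pose h := b / n%:R.
have h0 : 0 < h by rewrite divr_gt0.
have hn : h * n%:R = b by rewrite /h divfK ?lt0r_neq0.
have hz2 : 0 < h ^+ 2 by rewrite exprn_gt0.
have inb (j : lat) : lbox n j -> forall i, `|(c + h *: zv R j - c) ord0 i| <= b.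
  move=> hj i; rewrite (addrC c) addrK 2!mxE normrM gtr0_norm // -hn ler_pM2l //.
  by rewrite -intr_norm [leRHS]pmulrn ler_int.
have cont (P : 'rV[R]_N) (x : lat) : (forall i, `|P ord0 i| <= theta * n%:R) -> lbox n x ->
   lcontact n (fun y => lattice_fun f c h y + lattice_fun g c h y) x P ->
   (forall i, `|(h *: P) ord0 i| <= p0) /\
   f c + g c + dot (h *: P) (c + h *: zv R x - c) <= f (c + h *: zv R x) + g (c + h *: zv R x).
  move=> hP hx hc; split.
    move=> i; rewrite mxE normrM gtr0_norm // -ler_pdivlMl //.
    apply: le_trans (hP i) _; rewrite le_eqVlt; apply/orP; left; apply/eqP.
    by rewrite /theta /h; field; rewrite !lt0r_neq0.
  have /hc : lbox n (0 : lat) by move=> i; rewrite mxE.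
  rewrite /lattice_fun zv0 scaler0 addr0 sub0r zvN dotNr.
  rewrite (addrC c) addrK dotZl dotZr -!mulrDl ler_pdivrMr // mulrBl divfK ?lt0r_neq0 //.
  by rewrite expr2 (addrC _ c); lra.
have [P hP|x [P [a [a' [k [hk hP [hx hc] [nq1 nq2] [q hq]]]]]]] := good n (leq_addr _ _)
   (lattice_fun f c h) (lattice_fun g c h) (lattice_fun_supp c h0 sf) (lattice_fun_supp c h0 sg).
  have [x hx hmax] := lattice_max_exists
     (fun y => lattice_fun f c h y + lattice_fun g c h y - dot P (zv R y)) n.
  have hc : lcontact n (fun y => lattice_fun f c h y + lattice_fun g c h y) x P.
    by move=> y hy; have := hmax y hy; rewrite zvB dotBr; lra.
  exists x; split => // i.
  have [hp1 hp2] := cont P x hP hx hc.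
  have := hint _ _ hp1 (inb x hx) hp2 i.
  rewrite (addrC c) addrK 2!mxE normrM gtr0_norm // -hn -mulrA ler_pM2l //.
  rewrite ler_pdivlMr // -intr_norm [leRHS]pmulrn -[X in _ * X <= _]/(2%:~R) -intrM ler_int => hi.
  exact: normz_le_half.
have hxn : lbox n x by apply: lboxW hx; rewrite -divn2 leq_div.
have [hp1 hp2] := cont P x hP hxn hc.
pose x0 := c + h *: zv R x; pose eta := h * 6 * (2 ^ k)%:R.
have eta0 : 0 < eta by rewrite /eta; do 2!apply: mulr_gt0 => //; rewrite ltr0n expn_gt0.
have [l1 [H1 [z1 [s1 hH1 q1 b1 t1]]]] := near_quad_touched lam0 eta0 m0 (ltW tau0) kap0 cf sf nq1
  (fun j => coarse_blowE f c x a k j h0) hsig hnum.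
have [l2 [H2 [z2 [s2 hH2 q2 b2 t2]]]] := near_quad_touched lam0 eta0 m0 (ltW tau0) kap0 cg sg nq2
  (fun j => coarse_blowE g c x a' k j h0) hsig hnum.
have hz (z : 'rV[R]_N) i : (forall i, `|z ord0 i| < m%:R) ->
    `|(x0 + eta *: z - x0) ord0 i| <= rho.
  move=> hz; rewrite (addrC x0) addrK mxE normrM gtr0_norm //.
  apply: (@le_trans _ _ (eta * m%:R)); first by rewrite ler_pM2l // ltW.
  apply: (@le_trans _ _ (h * (6 * 2 ^ K * m)%N%:R)).
    have -> : eta * m%:R = h * (6 * 2 ^ k * m)%N%:R by rewrite /eta !natrM; ring.
    rewrite ler_pM2l // ler_nat leq_mul2r leq_mul2l /= leq_exp2l //.
    by rewrite (ltnW hk) ?orbT.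
  rewrite /h mulrAC ler_pdivrMr // mulrC (mulrC rho) -ler_pdivrMr //.
have hsum (j : lat) : lbox m j -> coarse (blow (lattice_fun f c h) x a k) j +
    coarse (blow (lattice_fun g c h) x a' k) j <= dot (6^-1 *: q) (zv R j).
  move=> hj; have /hq : lbox (6 * m + 40) (j *+ 6).
    by apply: lboxW (lboxMn 6 hj); rewrite leq_addr.
  by rewrite /coarse zvMn dotZr dotZl; lra.
have hle := lattice_hessian_le s1 s2 q1 q2 hsum.
have sH : (H1 + H2)^T = H1 + H2 by rewrite linearD /= s1 s2.
have hH i j : `|(H1 + H2) i j| <= 24 * lam.
  rewrite mxE; apply: le_trans (ler_normD _ _) _.
  by have := hH1 i j; have := hH2 i j; lra.
have hfin := quad_lattice_le m0 sH hH hle.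
exists x0, (h *: P), (x0 + eta *: z1), (x0 + eta *: z2), (H1 + kap%:M), (H2 + kap%:M).
split => //.
- by split; [apply: inb | exact: hp2].
- by move=> i; split; apply: hz.
- by split; rewrite ?linearD /= ?s1 ?s2 ?tr_scalar_mx.
move=> v; rewrite addrACA -raddfD /= mulmxDr mul_mx_scalar dotDl dotZl.
have vv := dot_ge0 v.
have -> : delta * dot v v = delta / 2 * dot v v + delta / 2 * dot v v by field.
apply: lerD; last by rewrite /kap ler_wpM2r //; lra.
apply: le_trans (hfin v) _; rewrite ler_wpM2r // ler_pdivrMr ?exprn_gt0 ?ltr0n //.
have h1 : delta * m%:R * m%:R <= delta * m%:R ^+ 2 by rewrite expr2 mulrA.
have h2 : 8 * T * m%:R <= delta * m%:R * m%:R by rewrite ler_wpM2r // ltW.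
have h3 : 0 <= lam * N%:R * m%:R by rewrite mulr_ge0.
by rewrite /T in h2; nra.
Qed.
End Core.

(** * Spectral norm *)

Section Spectral.
Variables (R : realType) (N : nat).
Implicit Types (A P : 'M[R]_N) (u v w x y : 'rV[R]_N).

Lemma sphere_compact : compact [set v : 'rV[R]_N | dot v v = 1].
Proof.
have cd : continuous (fun v : 'rV[R]_N => dot v v).
  by apply: continuous_dot => i; exact: coord_continuous.
apply: (@subclosed_compact _ _ [set v : 'rV[R]_N | forall i, `|v ord0 i| <= 1]).
- rewrite (_ : [set v | _] = (fun v => dot v v) @^-1` [set 1]); last by [].
  by apply: closed_comp; [move=> x _; apply: cd | apply: closed_eq].
- exact: cube_compact.
- by move=> v /= v1 i; have := coord_le_sqrt v i; rewrite v1 sqrtr1.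
Qed.

(** A maximizer v0 of the Rayleigh quotient on the sphere is an eigenvector: a nonzero residual r =
    a v0 - v0 A would allow v0 - t r to beat the maximum for small t. *)
Lemma rayleigh_eigenvalue A v k : A^T = A -> k * dot v v < dot (v *m A) v ->
  exists2 a, k < a & eigenvalue A a.
Proof.
move=> sA hv.
have vn0 : 0 < dot v v.
  rewrite lt_def dot_ge0 andbT; apply/eqP => /dot_eq0 e.
  by move: hv; rewrite e !dot0r mulr0 ltxx.
pose nrm (w : 'rV[R]_N) := (Num.sqrt (dot w w))^-1 *: w.
have nrm1 w : 0 < dot w w -> dot (nrm w) (nrm w) = 1.
  move=> w0; rewrite dotZl dotZr mulrA -invfM -expr2 sqr_sqrtr ?dot_ge0 // mulVf //.
  exact: lt0r_neq0.
have nrmA w : 0 < dot w w -> dot (nrm w *m A) (nrm w) = dot (w *m A) w / dot w w.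
  move=> w0; rewrite -scalemxAl dotZl dotZr mulrA -invfM -expr2 sqr_sqrtr ?dot_ge0 //.
  by rewrite mulrC.
have cA : continuous (fun v : 'rV[R]_N => dot (v *m A) v).
  apply: continuous_dot => i; [exact: continuous_mulmx_coord | exact: coord_continuous].
have [|x Kx e e0|v0 /= v01 hmax] := @usc_compact_max R _ _ (fun v => dot (v *m A) v) sphere_compact.
- by exists (nrm v); exact: nrm1.
- move/cvgrPdist_lt : (cA x) => /(_ e e0); apply: filterS => y /= + _.
  by rewrite ltr_norml => /andP[+ _]; lra.
set a := dot (v0 *m A) v0 in hmax.
have ha w : dot (w *m A) w <= a * dot w w.
  have [/dot_eq0 ->|w0] := eqVneq (dot w w) 0; first by rewrite !dot0r mulr0.
  have {}w0 : 0 < dot w w by rewrite lt_def w0 dot_ge0.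
  by rewrite -ler_pdivrMr // -nrmA //; apply: hmax; exact: nrm1.
exists a; first by rewrite -(ltr_pM2r vn0); apply: lt_le_trans hv (ha v).
apply/eigenvalueP; exists v0; last first.
  by apply/eqP => e; move: v01; rewrite e dot0r => /esym/eqP; rewrite oner_eq0.
pose r := a *: v0 - v0 *m A.
suff : r = 0 by move/eqP; rewrite subr_eq0 => /eqP ->.
apply: dot_eq0; apply/eqP; rewrite eq_le dot_ge0 andbT leNgt; apply/negP => r0.
have er : dot r r = a * dot v0 r - dot (v0 *m A) r by rewrite {1}/r dotBl dotZl.
clearbody r; pose c := a * dot r r - dot (r *m A) r.
have c0 : 0 <= c by rewrite subr_ge0.
have main t : 0 <= t ^+ 2 * c - 2 * t * dot r r.
  have := ha (v0 - t *: r).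
  rewrite mulmxBl -scalemxAl !(dotBl, dotBr, dotZl, dotZr) v01 -/a.
  rewrite (dot_mul_sym r v0 sA).
  rewrite /c (dotC r v0); move: er.
  move: (dot r r) (dot (r *m A) r) (dot v0 r) (dot (v0 *m A) r) => d1 d2 d3 d4.
  nra.
have c1 : 0 < c + 1 by lra.
(* The denominator c + 1 avoids dividing by c, which may vanish. *)
have := main (dot r r / (c + 1)).
rewrite leNgt => /negP; apply.
have -> : (dot r r / (c + 1)) ^+ 2 * c - 2 * (dot r r / (c + 1)) * dot r r
  = (dot r r / (c + 1)) ^+ 2 * (- c - 2).
  by field; apply: lt0r_neq0.
rewrite nmulr_llt0; last lra.
by rewrite exprn_gt0 // divr_gt0.
Qed.

(** Makes the supremum in [specnorm] a genuine one. *)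
Lemma eigenvalue_bounded A : exists C, forall a, eigenvalue A a -> `|a| <= C.
Proof.
pose h := \sum_i \sum_j `|A i j|.
have hA i j : `|A i j| <= h.
  rewrite /h (bigD1 i) //= (bigD1 j) //= -addrA lerDl addr_ge0 ?sumr_ge0 // => k _.
  by rewrite sumr_ge0.
exists (N%:R ^+ 2 * h) => a /eigenvalueP[v va v0].
have d0 : 0 < dot v v.
  by rewrite lt_def dot_ge0 andbT; apply: contra v0 => /eqP /dot_eq0 ->.
have := bil_bound (coord_le_sqrt v) (coord_le_sqrt v) hA.
rewrite va dotZl normrM (gtr0_norm d0) -expr2 sqr_sqrtr ?dot_ge0 //.
by rewrite mulrCA mulrC ler_pM2l.
Qed.

Lemma specnorm_ge A v : A^T = A -> `|dot (v *m A) v| <= specnorm A * dot v v.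
Proof.
move=> sA.
have ub a : eigenvalue A a -> `|a| <= specnorm A.
  move=> ea; apply: ub_le_sup; last by exists a.
  have [C hC] := eigenvalue_bounded A.
  by exists C => _ [b eb <-]; exact: hC.
rewrite ler_norml; apply/andP; split; rewrite leNgt; apply/negP => h.
  have : specnorm A * dot v v < dot (v *m - A) v by rewrite mulmxN dotNl; lra.
  move=> /rayleigh_eigenvalue[|a ka /eigenvalueP[w wa w0]]; first by rewrite linearN /= sA.
  have /ub : eigenvalue A (- a).
    by apply/eigenvalueP; exists w => //; rewrite scaleNr -wa mulmxN opprK.
  by rewrite normrN => /le_lt_trans /(_ ka); rewrite ltNge ler_norm.
have [a ka /ub /le_lt_trans /(_ ka)] := rayleigh_eigenvalue sA h.
by rewrite ltNge ler_norm.
Qed.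

Lemma specnorm_le A k : 0 <= k -> (forall v, `|dot (v *m A) v| <= k * dot v v) -> specnorm A <= k.
Proof.
move=> k0 h; rewrite /specnorm; set S := (X in sup X).
(* The set of eigenvalues can be empty, as for N = 0; [sup] is then 0, whence the assumption on
   k. *)
have [->|/set0P nS] := eqVneq S set0; first by rewrite sup0.
apply: ge_sup => // _ [a /eigenvalueP[v va v0] <-].
have d0 : 0 < dot v v.
  by rewrite lt_def dot_ge0 andbT; apply: contra v0 => /eqP /dot_eq0 ->.
by have := h v; rewrite va dotZl normrM (gtr0_norm d0) ler_pM2r.
Qed.

Lemma specnorm_scalar (k : R) : specnorm (k%:M : 'M[R]_N) <= `|k|.
Proof.
by apply: specnorm_le => // v; rewrite mul_mx_scalar dotZl normrM (ger0_norm (dot_ge0 v)).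
Qed.

Lemma psdE P : psd P <-> P^T = P /\ forall v, 0 <= dot (v *m P) v.
Proof. by split=> -[sP hP]; split=> // v; have := hP v; rewrite dotE. Qed.

Lemma jdist_lt p q e : Jsp p -> Jsp q -> jdist p q < e ->
  `|p.1 - q.1| < e /\ forall v, `|dot (v *m (p.2 - q.2)) v| <= e * dot v v.
Proof.
move=> sp sq; rewrite /jdist /jnorm /= gt_max => /andP[h1 h2]; split=> // v.
have sA : (p.2 - q.2)^T = p.2 - q.2.
  by rewrite linearB /=; congr (_ - _); [exact: sp | exact: sq].
by apply: le_trans (specnorm_ge v sA) _; rewrite ler_wpM2r ?dot_ge0 // ltW.
Qed.

Lemma symmxD_scalar A k : symmx A -> symmx (A + k%:M).
Proof. by rewrite /symmx => sA; rewrite linearD /= sA tr_scalar_mx. Qed.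

End Spectral.

(** * The map Theta *)

Section Eucl.
Variables (R : realType) (N : nat).
Implicit Types (x y : 'rV[R]_N).

Lemma coord_le_eucl x y i : `|(x - y) ord0 i| <= eucl_dist x y.
Proof.
apply: le_trans (coord_le_sqrt (x - y) i) _; rewrite le_eqVlt; apply/orP; left.
by apply/eqP; congr Num.sqrt; apply: eq_bigr => k _; rewrite !mxE expr2.
Qed.

Lemma eucl_distE x y : eucl_dist x y = Num.sqrt (dot (x - y) (x - y)).
Proof. by congr Num.sqrt; apply: eq_bigr => k _; rewrite !mxE expr2. Qed.

Lemma eucl_distC x y : eucl_dist x y = eucl_dist y x.
Proof. by rewrite !eucl_distE -opprB dotNl dotNr opprK. Qed.

Lemma near_eucl x d : 0 < d -> \forall y \near x, eucl_dist x y < d.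
Proof.
move=> d0.
have cd : continuous (fun y : 'rV[R]_N => dot (x - y) (x - y)).
  have cx i : continuous (fun y : 'rV[R]_N => (x - y) ord0 i).
    rewrite (_ : (fun _ => _) = (fun y : 'rV[R]_N => x ord0 i - y ord0 i)); last first.
      by apply/funext => y; rewrite !mxE.
    by move=> y; apply: continuousB; [exact: cst_continuous | exact: coord_continuous].
  exact: continuous_dot.
have d20 : 0 < d ^+ 2 by rewrite exprn_gt0.
move/cvgrPdist_lt : (cd x) => /(_ _ d20); apply: filterS => y /=.
rewrite subrr dot0r sub0r normrN ger0_norm ?dot_ge0 // eucl_distE => h.
by rewrite -[ltRHS]ger0_norm ?(ltW d0) // -sqrtr_sqr ltr_sqrt.
Qed.

Lemma nbhs_eucl x (A : set 'rV[R]_N) : nbhs x A ->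
  exists2 d : R, 0 < d & forall y, eucl_dist x y < d -> A y.
Proof.
move=> /nbhs_ballP[e /= e0 he]; exists e => // y hy; apply: he; split=> // i j.
rewrite ord1 /ball /=; apply: le_lt_trans hy.
by have := coord_le_eucl x y j; rewrite !mxE.
Qed.

Lemma nbhs_coord x (A : set 'rV[R]_N) : nbhs x A ->
  exists2 d : R, 0 < d & forall y, (forall i, `|(x - y) ord0 i| < d) -> A y.
Proof.
move=> /nbhs_ballP[e /= e0 he]; exists e => // y hy; apply: he; split=> // i j.
by rewrite ord1 /ball /=; have := hy j; rewrite !mxE.
Qed.

Lemma near_coord_lt x (d : R) : 0 < d -> \forall y \near x, forall i, `|(x - y) ord0 i| < d.
Proof.
move=> d0; have := near_eucl x d0; apply: filterS => y hy i.
exact: le_lt_trans (coord_le_eucl x y i) hy.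
Qed.

Lemma bounded_closure_cube (S : set 'rV[R]_N) : bounded_set S ->
  exists2 B : R, 0 < B & forall x, closure S x -> forall i, `|x ord0 i| <= B.
Proof.
move=> [M [_ hM]]; pose B := `|M| + 1.
have BM : M < B by rewrite /B; apply: le_lt_trans (ler_norm M) _; rewrite ltrDl.
exists B; first by rewrite /B ltr_wpDl.
have hS x : S x -> forall i, `|x ord0 i| <= B.
  move=> Sx i; have := hM B BM x Sx; apply: le_trans.
  rewrite /Num.Def.normr /= mx_normrE; exact: (le_bigmax _ (fun ij => `|x ij.1 ij.2|) (ord0, i)).
pose C := [set x : 'rV[R]_N | forall i, `|x ord0 i| <= B].
have cC : closed C.
  by apply: compact_closed; [exact: norm_hausdorff | exact: cube_compact].
move=> x Sx; suff : closure C x by rewrite -(closure_id C).1.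
by move: x Sx; apply: closure_subset => y Sy; exact: hS.
Qed.

Lemma bounded_closure_compact (S : set 'rV[R]_N) : bounded_set S -> compact (closure S).
Proof.
move=> /bounded_closure_cube[B _ hB].
apply: (subclosed_compact _ (@cube_compact R N B)); last by move=> x /hB.
exact: closed_closure.
Qed.

End Eucl.

Section ThetaProperties.
Variables (R : realType) (N : nat) (Om : set 'rV[R]_N)
    (F : 'rV[R]_N -> R -> 'M[R]_N -> R)
    (Phi : 'rV[R]_N -> set (R * 'M[R]_N)).
Hypothesis Ombnd : bounded_set Om.
Hypothesis Omopen : open Om.
Hypothesis Fcont : F_continuous Om F.
Hypothesis cases :
  ((proper_elliptic Om Phi /\ hausdorff_continuous Om Phi /\
    (forall x, Om x ->
       jboundary (Phi x) `<=` [set p | Jsp p /\ F x p.1 p.2 <= 0]))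
   \/
   ((forall x, Om x -> Phi x = Jsp (R:=R) (N:=N)) /\
    (forall x, Om x -> exists p, Jsp p /\ F x p.1 p.2 < 0))).
Hypothesis Fmono : forall x p q, Om x -> Phi x p -> Qset q ->
     F x p.1 p.2 <= F x (p.1 + q.1) (p.2 + q.2).
Hypothesis Fshift : forall Om' : set 'rV[R]_N, open Om' -> compact (closure Om') ->
     closure Om' `<=` Om ->
     forall eta : R, 0 < eta -> exists2 delta : R, 0 < delta &
       forall x y (p : R * 'M[R]_N), Om' x -> Om' y -> eucl_dist x y < delta -> Phi x p ->
         F x p.1 p.2 <= F y (p.1 - eta) (p.2 + eta%:M).
Hypothesis Gammane : forall x, Om x -> Gamma F x `&` Phi x !=set0.

Lemma Phi_sym x : Om x -> Phi x `<=` @Jsp R N.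
Proof.
by move=> Ox; case: cases => [[pe _]|[PJ _]]; [have [] := pe x Ox | rewrite PJ].
Qed.

Lemma Phi_closed x : Om x -> jclosed (Phi x).
Proof.
move=> Ox; case: cases => [[pe _]|[PJ _]]; first by have [] := pe x Ox.
by rewrite PJ // => p [].
Qed.

Lemma Phi_elliptic x p q : Om x -> Phi x p -> Qset q -> Phi x (jadd p q).
Proof.
move=> Ox; case: cases => [[pe _]|[PJ _]]; first by have [_ _ _ _] := pe x Ox; apply.
rewrite PJ //.
rewrite /Jsp /= /symmx => sp [_ [sq _]].
by rewrite linearD /= sp sq.
Qed.

Lemma Theta_sym x : Om x -> Theta F Phi x `<=` @Jsp R N.
Proof. by move=> Ox p [/(Phi_sym Ox)]. Qed.

Lemma Theta_elliptic x p q : Om x -> Theta F Phi x p -> Qset q -> Theta F Phi x (jadd p q).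
Proof.
move=> Ox [Pp Fp] Qq; split; first exact: Phi_elliptic.
exact: le_trans Fp (Fmono Ox Pp Qq).
Qed.

Lemma Theta_order x p q : Om x -> Theta F Phi x p -> Jsp q -> q.1 <= p.1 ->
  (forall v, dot (v *m p.2) v <= dot (v *m q.2) v) -> Theta F Phi x q.
Proof.
move=> Ox Tp sq h1 h2.
have -> : q = jadd p (q.1 - p.1, q.2 - p.2).
  by case: q {sq h1 h2} => q1 q2; rewrite /jadd /= !(addrC _ (_ - _)) !subrK.
apply: Theta_elliptic => //; split; rewrite /= ?subr_le0 //.
apply/psdE; split; last by move=> v; rewrite mulmxBr dotBl subr_ge0.
by rewrite linearB /=; congr (_ - _); [exact: sq | exact: Theta_sym Tp].
Qed.

Lemma Theta_closed x : Om x -> jclosed (Theta F Phi x).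
Proof.
move=> Ox p [sp hp]; split.
  apply: Phi_closed => //; split=> // e /hp[q [[Pq _] hq]].
  by exists q.
rewrite leNgt; apply/negP => Fp.
have Fp' : 0 < - F x p.1 p.2 by rewrite oppr_gt0.
have [d d0 hd] := Fcont p.1 Ox sp Fp'.
have [q [[Pq Fq] hq]] := hp d d0.
have := hq; rewrite /jdist /jnorm gt_max /= => /andP[h1 h2].
have dxx : eucl_dist x x < d by rewrite eucl_distE subrr dot0r sqrtr0.
have := hd x q.1 q.2 Ox (Phi_sym Ox Pq) dxx h1 h2.
by rewrite ltr_norml => /andP[h _]; lra.
Qed.

Lemma Theta_proper : proper_elliptic Om (Theta F Phi).
Proof.
move=> x Ox; split.
- exact: Theta_sym.
- exact: Theta_closed.
- by have [p [[_ Fp] Pp]] := Gammane Ox; exists p; split; rewrite ?Fp.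
(* If Theta were everything, so would Phi be in the constrained case, and F would have no negative
   value in the unconstrained one. *)
- apply/eqP => e; case: cases => [[pe _]|[_ /(_ x Ox)[p [sp Fp]]]].
    have [PJ _ _ /eqP PnJ _] := pe x Ox; apply: PnJ; apply/seteqP; split=> // p.
    by rewrite -e => -[].
  by move: sp; rewrite -/(Jsp p) -e => -[_]; rewrite leNgt Fp.
- by move=> p q; apply: Theta_elliptic.
Qed.

(** Where F > 0, assumption (v) places a point of Theta in the interior of Phi, and by continuity of
    F in the interior of Theta. *)
Lemma Theta_boundary x : Om x -> jboundary (Theta F Phi x) `<=` Gamma F x.
Proof.
move=> Ox p [cp ip]; have [Pp Fp] := Theta_closed Ox cp; have [sp _] := cp.
split=> //; apply/eqP; rewrite eq_le Fp andbT leNgt; apply/negP => Fp0.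
have iP : jinterior (Phi x) p.
  case: cases => [[_ [_ hb]]|[PJ _]]; last by rewrite PJ //; split=> //; exists 1.
  apply: contrapT => niP; have [|_] := hb x Ox p; last by rewrite leNgt Fp0.
  by split=> //; split=> // e e0; have [q [[Pq _] hq]] := cp.2 e e0; exists q.
have [_ [e e0 he]] := iP.
have [d d0 hd] := Fcont p.1 Ox sp Fp0.
apply: ip; split=> //; exists (Num.min e d); first by rewrite lt_min e0.
move=> q sq; rewrite lt_min => /andP[qe qd]; split; first exact: he.
have := qd; rewrite /jdist /jnorm gt_max /= => /andP[h1 h2].
have dxx : eucl_dist x x < d by rewrite eucl_distE subrr dot0r sqrtr0.
have := hd x q.1 q.2 Ox sq dxx h1 h2.
by rewrite ltr_norml => /andP[_ h]; lra.
Qed.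

Lemma setdist_lt (p : R * 'M[R]_N) Y (eta : R) : (setdist p Y < eta%:E)%E ->
  exists2 q, Y q & jdist p q < eta.
Proof.
by move=> /ereal_inf_lt[_ [q Yq <-]]; rewrite lte_fin; exists q.
Qed.

(** A point within eta of an element q of Phi dominates q once it is shifted by (-eta, eta I), so
    ellipticity applies. *)
Lemma Phi_shift x eta : Om x -> 0 < eta -> exists2 d : R, 0 < d &
  forall y, Om y -> eucl_dist x y < d -> forall p,
  (Phi x p -> Phi y (p.1 - eta, p.2 + eta%:M)) /\ (Phi y p -> Phi x (p.1 - eta, p.2 + eta%:M)).
Proof.
move=> Ox eta0; case: (cases) => [[pe [hc _]]|[PJ _]]; last first.
  exists 1 => // y Oy _ p; rewrite !PJ // /Jsp /=.
  by split; apply: symmxD_scalar.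
have [d d0 hd] := hc x Ox eta eta0; exists d => // y Oy xy p.
have := hd y Oy xy; rewrite /hausdorff gt_max => /andP[h1 h2].
have key z q : Om z -> Phi z q -> Jsp p -> jdist p q < eta -> Phi z (p.1 - eta, p.2 + eta%:M).
  move=> Oz Pq sp pq.
  have [e1 e2] := jdist_lt sp (Phi_sym Oz Pq) pq.
  have -> : (p.1 - eta, p.2 + eta%:M) = jadd q (p.1 - eta - q.1, p.2 + eta%:M - q.2).
    by rewrite /jadd /= !(addrC _ (_ - _)) !subrK.
  apply: Phi_elliptic => //; split => /=.
    by move: e1; rewrite ltr_norml => /andP[_]; lra.
  apply/psdE; split.
    rewrite linearB /=; congr (_ - _); last exact: (Phi_sym Oz Pq).
    exact: (symmxD_scalar eta sp).
  move=> v; have := e2 v; rewrite addrAC ler_norml => /andP[+ _].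
  by rewrite [X in _ -> 0 <= dot X _]mulmxDr mul_mx_scalar dotDl dotZl; lra.
split=> Pp.
  have : (setdist p (Phi y) < eta%:E)%E.
    by apply: le_lt_trans h1; apply: ereal_sup_ubound; exists p.
  move=> /setdist_lt[q Pq pq]; apply: key Pq _ pq => //; exact: Phi_sym Pp.
have : (setdist p (Phi x) < eta%:E)%E.
  by apply: le_lt_trans h2; apply: ereal_sup_ubound; exists p.
move=> /setdist_lt[q Pq pq]; apply: key Pq _ pq => //; exact: (Phi_sym Oy Pp).
Qed.

(** The form of continuity that both [Theta_hausdorff] and the comparison argument use: [Phi_shift]
    handles the constraint, and (ii) on a ball with compact closure in Om handles the sign of F. *)
Lemma Theta_shift x eta : Om x -> 0 < eta -> exists2 d : R, 0 < d &
  forall y, Om y -> eucl_dist x y < d -> forall p,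
  (Theta F Phi x p -> Theta F Phi y (p.1 - eta, p.2 + eta%:M)) /\
  (Theta F Phi y p -> Theta F Phi x (p.1 - eta, p.2 + eta%:M)).
Proof.
move=> Ox eta0.
have [d1 d10 h1] := Phi_shift Ox eta0.
have : nbhs x Om by exact: open_nbhs_nbhs.
move=> /nbhs_ballP[e /= e0 he].
pose Om' := ball x (e / 2).
have e20 : 0 < e / 2 by rewrite divr_gt0.
have clO : closure Om' `<=` Om.
  move=> y cy; apply: he.
  have [z [xz yz]] := cy _ (nbhsx_ballx y (e / 2) e20).
  rewrite (splitr e); apply: ball_triangle xz _; exact: ball_sym.
have cO : compact (closure Om').
  apply: (subclosed_compact _ (bounded_closure_compact Ombnd)); first exact: closed_closure.
  by move=> y /clO; exact: subset_closure.
have [d2 d20 h2] := Fshift (ball_open x (e / 2)) cO clO eta0.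
have [d3 d30 h3] := nbhs_eucl (nbhsx_ballx x (e / 2) e20).
exists (Num.min d1 (Num.min d2 d3)); first by rewrite !lt_min d10 d20.
move=> y Oy; rewrite !lt_min => /and3P[xy1 xy2 xy3] p.
have [k1 k2] := h1 y Oy xy1 p.
have Ox' : Om' x by exact: ballxx.
split=> -[Pp Fp]; split; [exact: k1 | | exact: k2 |].
  apply: le_trans Fp _; apply: h2 => //; exact: h3.
apply: le_trans Fp _; apply: h2; rewrite ?[eucl_dist y x]eucl_distC //; exact: h3.
Qed.

Lemma Theta_hausdorff : hausdorff_continuous Om (Theta F Phi).
Proof.
move=> x Ox eta eta0.
have e20 : 0 < eta / 2 by rewrite divr_gt0.
have [d d0 hd] := Theta_shift Ox e20; exists d => // y Oy xy.
have key p Y : Y (p.1 - eta / 2, p.2 + (eta / 2)%:M) -> (setdist p Y <= (eta / 2)%:E)%E.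
  move=> Yp; apply: ge_ereal_inf; exists (jdist p (p.1 - eta / 2, p.2 + (eta / 2)%:M))%:E.
    by exists (p.1 - eta / 2, p.2 + (eta / 2)%:M).
  rewrite lee_fin /jdist /jnorm /= !opprD !opprK !addrA !subrr !add0r -raddfN /= ge_max.
  rewrite gtr0_norm // lexx /=; apply: le_trans (specnorm_scalar _ _) _.
  by rewrite normrN gtr0_norm.
apply: (@le_lt_trans _ _ (eta / 2)%:E); last by rewrite lte_fin; lra.
rewrite /hausdorff ge_max; apply/andP; split; apply: ge_ereal_sup => _ [p Tp <-]; apply: key.
  by have [k _] := hd y Oy xy p; exact: k.
by have [_ k] := hd y Oy xy p; exact: k.
Qed.

End ThetaProperties.

(** * Jets and sup-convolutions *)

Section Jets.
Variables (R : realType) (N : nat).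
Implicit Types (x y z l : 'rV[R]_N) (X : 'M[R]_N).

Definition cquad (c0 : R) l X x0 : 'rV[R]_N -> R := fun y => c0 + quad l X (y - x0).

Lemma dot_evec l i : dot l (evec R i) = l ord0 i.
Proof.
rewrite /dot (bigD1 i) //= big1 => [|k ki]; rewrite !mxE eqxx /=.
  by rewrite eqxx mulr1 addr0.
by rewrite (negbTE ki) mulr0.
Qed.

Lemma cquad_cvg c0 l X x0 y i : X^T = X ->
  (fun h : R => h^-1 *: ((cquad c0 l X x0 \o shift y) (h *: evec R i) - cquad c0 l X x0 y))
    @ 0^' --> (l + (y - x0) *m X) ord0 i.
Proof.
move=> sX; apply/cvgrPdist_lt => e e0.
set L := (l + _) ord0 i; pose c := dot (evec R i *m X) (evec R i) / 2.
near=> h.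
have h0 : h != 0 by near: h; exact: nbhs_dnbhs_neq.
have -> : h^-1 *: ((cquad c0 l X x0 \o shift y) (h *: evec R i) - cquad c0 l X x0 y) = L + h * c.
  rewrite /cquad /=.
  have -> : h *: evec R i + y - x0 = y - x0 + h *: evec R i by rewrite -addrA addrC.
  rewrite (quadD l (y - x0) (h *: evec R i) sX) -scalemxAl !(dotZl, dotZr) dot_evec -/L.
  by rewrite /c /GRing.scale /=; field.
rewrite opprD addrA subrr add0r normrN normrM.
have hc : 0 < `|c| + 1 by rewrite ltr_wpDl.
have : `|h| < e / (`|c| + 1) by near: h; apply: dnbhs0_lt; rewrite divr_gt0.
rewrite ltr_pdivlMr // => /(le_lt_trans _); apply.
by rewrite ler_wpM2l // lerDl.
Unshelve. all: by end_near.
Qed.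

Lemma cquad_derivable c0 l X x0 y i : X^T = X -> derivable (cquad c0 l X x0) y (evec R i).
Proof. by move=> sX; apply: cvgP; exact: cquad_cvg. Qed.

(** The derivative is again a [cquad], so second derivatives need no separate computation. *)
Lemma partial_cquad c0 l X x0 i : X^T = X ->
  partial i (cquad c0 l X x0) = cquad (l ord0 i) (row i X) 0 x0.
Proof.
move=> sX; apply/funext => y.
have -> : partial i (cquad c0 l X x0) y = (l + (y - x0) *m X) ord0 i.
  by apply: cvg_lim => //; exact: cquad_cvg.
rewrite /cquad /quad mulmx0 dot0l mul0r addr0 mxE; congr (_ + _).
by rewrite -dot_evec dot_mul_sym // rowE.
Qed.

Lemma cquad_continuous c0 l X x0 : continuous (cquad c0 l X x0).
Proof.
move=> y; apply: (@continuousD R R 'rV[R]_N (fun=> c0) (fun y => quad l X (y - x0)));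
  first exact: cst_continuous.
apply: (@continuous_comp 'rV[R]_N 'rV[R]_N R (fun y => y - x0) (quad l X)).
  by apply: (@continuousB R 'rV[R]_N 'rV[R]_N id (fun=> x0)); [exact: cvg_id | exact: cst_continuous].
exact: continuous_quad.
Qed.

Lemma cquad_C2 c0 l X x0 U : X^T = X ->
  C2_on U (cquad c0 l X x0) /\ hessian (cquad c0 l X x0) x0 = X.
Proof.
move=> sX; split.
  split=> [x i _|x i j _|x _|x j _|x i j _].
  - exact: cquad_derivable.
  - by rewrite partial_cquad //; apply: cquad_derivable; rewrite trmx0.
  - exact: cquad_continuous.
  - by rewrite partial_cquad //; apply: cquad_continuous.
  - by rewrite !partial_cquad ?trmx0 //; apply: cquad_continuous.
apply/matrixP => i j; rewrite mxE !partial_cquad ?trmx0 // /cquad subrr /quad !dot0r mul0r !addr0.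
by rewrite mxE -{1}sX mxE.
Qed.

Lemma superjet_quad Om u x0 l X r : X^T = X -> 0 < r ->
  (forall y, Om y -> (forall i, `|(y - x0) ord0 i| < r) -> u y <= u x0 + quad l X (y - x0)) ->
  superjet Om u x0 (u x0, X).
Proof.
move=> sX r0 h; exists (cquad (u x0) l X x0), r => //.
have c0 : cquad (u x0) l X x0 x0 = u x0 by rewrite /cquad subrr /quad !dot0r mul0r !addr0.
have [h1 h2] := cquad_C2 (u x0) l x0 (ball_e x0 r) sX; split=> //; last by rewrite c0 h2.
move=> y Oy hy; apply: h => // i; rewrite eucl_distC in hy.
exact: le_lt_trans (coord_le_eucl y x0 i) hy.
Qed.

Lemma subjet_quad Om u x0 l X r : X^T = X -> 0 < r ->
  (forall y, Om y -> (forall i, `|(y - x0) ord0 i| < r) -> u x0 + quad l X (y - x0) <= u y) ->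
  subjet Om u x0 (u x0, X).
Proof.
move=> sX r0 h; exists (cquad (u x0) l X x0), r => //.
have c0 : cquad (u x0) l X x0 x0 = u x0 by rewrite /cquad subrr /quad !dot0r mul0r !addr0.
have [h1 h2] := cquad_C2 (u x0) l x0 (ball_e x0 r) sX; split=> //; last by rewrite c0 h2.
move=> y Oy hy; apply: h => // i; rewrite eucl_distC in hy.
exact: le_lt_trans (coord_le_eucl y x0 i) hy.
Qed.

End Jets.

Section SupConvolution.
Variables (R : realType) (N : nat) (K : set 'rV[R]_N) (lam : R) (h : 'rV[R]_N -> R).
Hypothesis lam0 : 0 < lam.

(** The maximizer [xi] is part of the data because jets of f at z are transported to [xi z]. *)
Definition is_supconv (f : 'rV[R]_N -> R) (xi : 'rV[R]_N -> 'rV[R]_N) :=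
  (forall z, K (xi z) /\ f z = h (xi z) - lam / 2 * dot (xi z - z) (xi z - z)) /\
  (forall z y, K y -> h y - lam / 2 * dot (y - z) (y - z) <= f z).

Lemma supconv_exists : compact K -> K !=set0 -> usc_on K h -> exists f xi, is_supconv f xi.
Proof.
move=> cK nK usc.
have H z : exists x, K x /\ forall y, K y ->
    h y - lam / 2 * dot (y - z) (y - z) <= h x - lam / 2 * dot (x - z) (x - z).
  have cq : continuous (fun y : 'rV[R]_N => cquad 0 0 1%:M z y).
    exact: cquad_continuous.
  have qE y : dot (y - z) (y - z) = 2 * cquad 0 0 1%:M z y.
    by rewrite /cquad /quad add0r dot0l add0r mulmx1; field.
  have [x Kx e e0|x Kx hx] :=
    @usc_compact_max R _ K (fun y => h y - lam / 2 * dot (y - z) (y - z)) cK nK.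
  - have e20 : 0 < e / 2 by rewrite divr_gt0.
    have el0 : 0 < e / 2 / lam by rewrite divr_gt0.
    have [d d0 hd] := usc x Kx (e / 2) e20.
    have := near_eucl x d0; move/cvgrPdist_lt : (cq x) => /(_ _ el0).
    apply: filterS2 => y /= h1 h2 Ky; have := hd y Ky h2.
    rewrite !qE; move: h1; rewrite ltr_pdivlMr // => h1.
    have : (cquad 0 0 1%:M z x - cquad 0 0 1%:M z y) * lam < e / 2.
      by apply: le_lt_trans h1; rewrite ler_wpM2r ?ler_norm ?ltW.
    by move: (cquad _ _ _ _ x) (cquad _ _ _ _ y) => q1 q2; lra.
  - by exists x.
have [xi hxi] := choice H.
exists (fun z => h (xi z) - lam / 2 * dot (xi z - z) (xi z - z)), xi; split.
  by move=> z; have [? _] := hxi z.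
by move=> z y Ky; have [_] := hxi z; apply.
Qed.

Variables (f : 'rV[R]_N -> R) (xi : 'rV[R]_N -> 'rV[R]_N).
Hypothesis fxi : is_supconv f xi.

(** Use [xi z] as a competitor at y and expand the square. *)
Lemma supconv_support z y :
  f z + dot (lam *: (xi z - z)) (y - z) - lam / 2 * dot (y - z) (y - z) <= f y.
Proof.
have [Kz ->] := fxi.1 z; apply: le_trans (fxi.2 y _ Kz).
have -> : xi z - y = (xi z - z) - (y - z) by rewrite opprB addrA subrK.
move: (xi z - z) (y - z) => a b; rewrite !(dotZl, dotBl, dotBr) (dotC b a).
rewrite le_eqVlt; apply/orP; left; apply/eqP; by field.
Qed.

Lemma supconv_semicvx : semicvx lam f.
Proof. by move=> z; exists (lam *: (xi z - z)) => y; apply: supconv_support. Qed.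

(** The supporting slopes are bounded on bounded sets, which gives a local Lipschitz estimate. *)
Lemma supconv_lower (B C rho : R) (z y : 'rV[R]_N) : (forall x, K x -> forall i, `|x ord0 i| <= B) ->
  (forall i, `|z ord0 i| <= C) -> (forall i, `|(y - z) ord0 i| <= rho) ->
  f z - N%:R * (lam * (B + C) * rho + lam / 2 * rho ^+ 2) <= f y.
Proof.
move=> hB hC hr; apply: le_trans (supconv_support z y).
have h1 : dot (lam *: (z - xi z)) (y - z) <= N%:R * (lam * (B + C) * rho).
  apply: sum_le_const => i; apply: le_trans (ler_norm _) _; rewrite normrM.
  apply: ler_pM => //; rewrite mxE normrM gtr0_norm // ler_pM2l // !mxE [leRHS]addrC.
  apply: le_trans (ler_normB _ _) _; apply: lerD; first exact: hC.
  by apply: hB; have [] := fxi.1 z.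
have h2 : dot (y - z) (y - z) <= N%:R * rho ^+ 2.
  apply: sum_le_const => i; rewrite -expr2 -real_normK ?num_real //.
  by apply: lerXn2r => //; rewrite nnegrE //; apply: le_trans (hr i).
have h3 : lam / 2 * dot (y - z) (y - z) <= lam / 2 * (N%:R * rho ^+ 2).
  by rewrite ler_pM2l // divr_gt0.
by move: h1; rewrite -opprB scalerN dotNl; lra.
Qed.

Lemma supconv_continuous (B : R) : (forall x, K x -> forall i, `|x ord0 i| <= B) -> continuous f.
Proof.
move=> hB; suff H (z : 'rV[R]_N) : f y @[y --> z] --> f z by move=> z; exact: H.
apply: (cvgrPdist_lt (F := nbhs z) f (f z)).2 => e e0.
pose C := Num.sqrt (dot z z) + 1.
pose T := N%:R * (lam * (`|B| + C) + lam / 2).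
have s0 : 0 <= Num.sqrt (dot z z) by exact: sqrtr_ge0.
have C0 : 0 <= C by rewrite /C addr_ge0.
have T0 : 0 <= T by rewrite mulr_ge0 // addr_ge0 // ?mulr_ge0 ?addr_ge0 ?divr_ge0 // ltW.
have hB' x : K x -> forall i, `|x ord0 i| <= `|B|.
  by move=> Kx i; apply: le_trans (hB x Kx i) (ler_norm B).
pose rho := Num.min 1 (e / (T + 1)).
have rho0 : 0 < rho by rewrite lt_min ltr01 divr_gt0 // ltr_wpDl.
have rho1 : rho <= 1 by rewrite ge_min lexx.
have rT : T * rho < e.
  have : rho * (T + 1) <= e by rewrite -ler_pdivlMr ?ge_min ?lexx ?orbT // ltr_wpDl.
  by rewrite mulrDr mulr1 mulrC; lra.
have bnd : N%:R * (lam * (`|B| + C) * rho + lam / 2 * rho ^+ 2) <= T * rho.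
  rewrite /T -[leRHS]mulrA ler_wpM2l // [leRHS]mulrDl lerD2l expr2 mulrA.
  by rewrite ler_piMr // mulr_ge0 ?divr_ge0 // ltW.
have := near_coord_lt z rho0; apply: filterS => y hy.
have zC i : `|z ord0 i| <= C by apply: le_trans (coord_le_sqrt z i) _; rewrite lerDl.
have yC i : `|y ord0 i| <= C.
  have -> : y ord0 i = z ord0 i - (z - y) ord0 i by rewrite !mxE subKr.
  apply: le_trans (ler_normB _ _) _; apply: lerD; first exact: coord_le_sqrt.
  by apply: le_trans rho1; exact/ltW/hy.
have h1 := @supconv_lower `|B| C rho z y hB' zC.
have h2 := @supconv_lower `|B| C rho y z hB' yC (fun i => ltW (hy i)).
have {}h1 : f z - T * rho <= f y.
  apply: le_trans (h1 _); first by rewrite lerD2l lerN2.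
  by move=> i; rewrite -opprB mxE normrN; exact/ltW/hy.
by rewrite ltr_norml; move: h1 h2 bnd rT; lra.
Qed.

(** At the point z + (y - xi z) the competitor y pays the same penalty as [xi z] does at z, so the
    touching paraboloid translates with its Hessian unchanged. *)
Lemma supconv_touched z X : touched f z X -> exists2 r, 0 < r & exists l, forall y, K y ->
  (forall i, `|(y - xi z) ord0 i| < r) -> h y <= h (xi z) + quad l X (y - xi z).
Proof.
move=> [r r0 [l H]]; exists r => //; exists l => y Ky hy.
have e1 : z + (y - xi z) - z = y - xi z by rewrite addrAC subrr add0r.
have := H (z + (y - xi z)); rewrite e1 => /(_ hy).
have := fxi.2 (z + (y - xi z)) y Ky.
have [_ ->] := fxi.1 z.
have -> : y - (z + (y - xi z)) = xi z - z by rewrite opprD opprB addrCA (addrC y) subrK addrC.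
by lra.
Qed.

End SupConvolution.

(** * Comparison *)

Section Comparison.
Variables (R : realType) (N : nat).
Implicit Types (x y c : 'rV[R]_N).

Lemma lebesgue_number (K : set 'rV[R]_N) (Q : 'rV[R]_N -> 'rV[R]_N -> Prop) : compact K ->
  (forall c, K c -> exists2 s : R, 0 < s & forall x y, K x -> K y ->
     (forall i, `|(c - x) ord0 i| < s) -> (forall i, `|(c - y) ord0 i| < s) -> Q x y) ->
  exists2 s : R, 0 < s & forall x y, K x -> K y -> (forall i, `|(x - y) ord0 i| <= s) -> Q x y.
Proof.
move=> /compact_near_coveringP ncK H.
pose P (s : R) x := K x -> forall y, K y -> (forall i, `|(x - y) ord0 i| <= s) -> Q x y.
have H1 c : K c -> \forall x \near c & s \near 0^'+, P s x.
  move=> Kc; have [s s0 hs] := H c Kc.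
  have s20 : 0 < s / 2 by rewrite divr_gt0.
  exists ([set x | forall i, `|(c - x) ord0 i| < s / 2], [set t | t < s / 2]) => /=.
    by split; [exact: near_coord_lt | apply: nbhs_right_lt].
  move=> [x t] /= [hx ht] Kx y Ky hy; apply: hs => // i.
    by apply: lt_trans (hx i) _; lra.
  have -> : (c - y) ord0 i = (c - x) ord0 i + (x - y) ord0 i by rewrite !mxE addrA subrK.
  by apply: le_lt_trans (ler_normD _ _) _; have := hx i; have := hy i; lra.
have [e /= e0 he] := ncK _ _ P _ H1.
exists (e / 2); first by rewrite divr_gt0.
move=> x y Kx Ky hxy; apply: (he (e / 2)) => //=; last by rewrite divr_gt0.
by rewrite sub0r normrN gtr0_norm ?divr_gt0 //; lra.
Qed.

Lemma usc_on_max (K : set 'rV[R]_N) (h : 'rV[R]_N -> R) : compact K -> K !=set0 -> usc_on K h ->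
  exists2 x, K x & forall y, K y -> h y <= h x.
Proof.
move=> cK nK usc; apply: usc_compact_max => // x Kx e e0.
have [d d0 hd] := usc x Kx e e0.
by have := near_eucl x d0; apply: filterS => y hy Ky; exact: hd.
Qed.

Section Setting.
Variables (Om : set 'rV[R]_N) (Th : 'rV[R]_N -> set (R * 'M[R]_N)).
Hypothesis Ombnd : bounded_set Om.
Hypothesis Omopen : open Om.
Hypothesis Th_order : forall x p q, Om x -> Th x p -> Jsp q -> q.1 <= p.1 ->
  (forall v, dot (v *m p.2) v <= dot (v *m q.2) v) -> Th x q.
Hypothesis Th_shift : forall x eta, Om x -> 0 < eta -> exists2 d : R, 0 < d &
  forall y, Om y -> eucl_dist x y < d -> forall p,
  (Th x p -> Th y (p.1 - eta, p.2 + eta%:M)) /\ (Th y p -> Th x (p.1 - eta, p.2 + eta%:M)).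
Variables u v : 'rV[R]_N -> R.
Local Notation K := (closure Om).
Hypothesis uusc : usc_on K u.
Hypothesis vlsc : lsc_on K v.
Hypothesis usub : forall x p, Om x -> superjet Om u x p -> Th x p.
Hypothesis vsuper : forall x p, Om x -> subjet Om v x p -> ~ jinterior (Th x) p.
Hypothesis uvbd : forall x, (K `\` Om) x -> u x <= v x.

(** Near a boundary point, u <= v and semicontinuity with margin M/8 on each side force u x - v y <
    M/4. Near an interior point c, Th is compared through c at cost kap/2 each way. *)
Lemma doubling_localization (M kap : R) : 0 < M -> 0 < kap ->
  exists2 s : R, 0 < s & forall x y, K x -> K y -> (forall i, `|(x - y) ord0 i| <= s) ->
    M / 4 <= u x - v y ->
    [/\ Om x, Om y & forall p, Th x p -> Th y (p.1 - kap, p.2 + kap%:M)].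
Proof.
move=> M0 kap0; apply: lebesgue_number; first exact: bounded_closure_compact.
move=> c Kc; have [Oc|nOc] := pselect (Om c).
  have k20 : 0 < kap / 2 by rewrite divr_gt0.
  have [d d0 hd] := Th_shift Oc k20.
  have nO : nbhs c Om by exact: open_nbhs_nbhs.
  have : \forall y \near c, Om y /\ eucl_dist c y < d.
    by apply: filterI => //; exact: near_eucl.
  move=> /nbhs_coord[s s0 hs]; exists s => // x y _ _ /hs[Ox cx] /hs[Oy cy] _; split=> // p Tp.
  have /= [_ /(_ Tp) T1] := hd x Ox cx p.
  have /= [/(_ T1) T2 _] := hd y Oy cy (p.1 - kap / 2, p.2 + (kap / 2)%:M).
  move: T2 => /=; rewrite -addrA -opprD -[X in _ - X]splitr.
  by rewrite -addrA -raddfD /= -splitr.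
have M80 : 0 < M / 8 by rewrite divr_gt0.
have [d1 d10 h1] := uusc Kc M80; have [d2 d20 h2] := vlsc Kc M80.
have : \forall y \near c, eucl_dist c y < d1 /\ eucl_dist c y < d2.
  by apply: filterI; exact: near_eucl.
move=> /nbhs_coord[s s0 hs]; exists s => // x y Kx Ky /hs[cx _] /hs[_ cy].
have := h1 x Kx cx; have := h2 y Ky cy; have := uvbd (conj Kc nOc); lra.
Qed.

Lemma usc_opp_lsc : usc_on K (fun x => - v x).
Proof.
move=> x Kx e e0; have [d d0 hd] := vlsc Kx e0; exists d => // y Ky xy.
by have := hd y Ky xy; lra.
Qed.

Lemma usc_perturb (B del : R) : 0 <= del -> usc_on K (fun x => u x + del * (dot x x - B)).
Proof.
move=> del0 x Kx e e0.
have cd : continuous (fun y : 'rV[R]_N => dot y y).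
  by apply: continuous_dot => i; exact: coord_continuous.
have e20 : 0 < e / 2 by rewrite divr_gt0.
have t0 : 0 < e / 2 / (del + 1) by rewrite divr_gt0 // ltr_wpDl.
have [d d0 hd] := uusc Kx e20.
have : \forall y \near x, eucl_dist x y < d /\ dot y y < dot x x + e / 2 / (del + 1).
  apply: filterI; first exact: near_eucl.
  move/cvgrPdist_lt : (cd x) => /(_ _ t0); apply: filterS => y /=.
  by rewrite ltr_norml => /andP[+ _]; lra.
move=> /nbhs_eucl[d' d'0 hd']; exists d' => // y Ky /hd'[xy].
have := hd y Ky xy => h1.
set t := e / 2 / _ in t0 * => h2.
have h3 : del * (dot y y - dot x x) <= del * t by rewrite ler_wpM2l //; lra.
have h4 : del * t <= e / 2.
  have -> : e / 2 = (del + 1) * t by rewrite /t [RHS]mulrC divfK // lt0r_neq0 // ltr_wpDl.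
  by rewrite mulrDl mul1r; lra.
by move: h3; rewrite !mulrBr; lra.
Qed.

Lemma comparison_principle x : Om x -> u x <= v x.
Proof.
move=> Ox; rewrite leNgt; apply/negP => uv.
pose M := u x - v x; have M0 : 0 < M by rewrite subr_gt0.
have cK : compact K by exact: bounded_closure_compact.
have Kx : K x by exact: subset_closure.
have nK : K !=set0 by exists x.
have [BK BK0 hBK] := bounded_closure_cube Ombnd.
pose B := N%:R * BK ^+ 2.
have B0 : 0 <= B by rewrite mulr_ge0 // sqr_ge0.
have hB y : K y -> dot y y <= B.
  move=> Ky; apply: sum_le_const => i; rewrite -expr2 -real_normK ?num_real //.
  by apply: lerXn2r; rewrite ?nnegrE ?(ltW BK0) //; apply: hBK.
(* The perturbation of u then lies between -M/8 and 0 on the closure. *)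
pose del := M / (8 * (B + 1)).
have del0 : 0 < del by rewrite divr_gt0 // mulr_gt0 // ltr_wpDl.
have delB : del * B <= M / 8.
  have -> : M / 8 = del * (B + 1) by rewrite /del; field; rewrite lt0r_neq0 // ltr_wpDl.
  by rewrite ler_pM2l // lerDl.
pose ud y := u y + del * (dot y y - B).
have ud_le y : K y -> ud y <= u y.
  by move=> Ky; rewrite gerDl pmulr_rle0 // subr_le0 hB.
have udx : u x - M / 8 <= ud x.
  rewrite lerD2l mulrBr; have : 0 <= del * dot x x by rewrite mulr_ge0 ?dot_ge0 // ltW.
  lra.
(* In the final comparison 2 kap must not exceed the gap M/2 in values nor the gap del in
   Hessians. *)
pose kap := Num.min (M / 4) (del / 2).
have kap0 : 0 < kap by rewrite lt_min; apply/andP; split; apply: divr_gt0.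
have kapM : kap <= M / 4 by rewrite ge_min lexx.
have kapd : kap <= del / 2 by rewrite ge_min lexx orbT.
have [s s0 hs] := doubling_localization M0 kap0.
have uscv := usc_opp_lsc.
have uscu := @usc_perturb B del (ltW del0).
have [xm Kxm hxm] := usc_on_max cK nK uscu.
have [ym Kym hym] := usc_on_max cK nK uscv.
pose U := ud xm - v ym.
have hU y z : K y -> K z -> ud y - v z <= U.
  by move=> Ky Kz; apply: lerD; [exact: hxm | exact: hym].
have U0 : 0 < U by apply: lt_le_trans (hU x x Kx Kx); rewrite /M in M0 udx; lra.
(* The distance from [xi z1] to [et z2] is covered by four steps of length at most t: two to the
   maximizers and two of length rho. *)
pose t := s / 4; have t0 : 0 < t by rewrite divr_gt0.
pose lam := 2 * U / t ^+ 2.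
have lam0 : 0 < lam by rewrite divr_gt0 ?mulr_gt0 ?exprn_gt0.
have [f [xi fxi]] := @supconv_exists R N K lam ud lam0 cK nK uscu.
have [g [et get]] := @supconv_exists R N K lam (fun y => - v y) lam0 cK nK uscv.
(* The maximizers stay within [t] of [z1] and [z2], since [lam t^2 / 2 = U] *)
have close z1 z2 : 0 < f z1 + g z2 ->
    (forall i, `|(xi z1 - z1) ord0 i| <= t /\ `|(et z2 - z2) ord0 i| <= t) /\
    f z1 + g z2 <= ud (xi z1) - v (et z2).
  have [K1 e1] := fxi.1 z1; have [K2 e2] := get.1 z2.
  move=> h; have hu := hU _ _ K1 K2.
  have d1 := dot_ge0 (xi z1 - z1); have d2 := dot_ge0 (et z2 - z2).
  have l1 : 0 <= lam / 2 * dot (xi z1 - z1) (xi z1 - z1) by rewrite mulr_ge0 // divr_ge0 // ltW.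
  have l2 : 0 <= lam / 2 * dot (et z2 - z2) (et z2 - z2) by rewrite mulr_ge0 // divr_ge0 // ltW.
  have bnd (w : 'rV[R]_N) i : lam / 2 * dot w w <= U -> `|w ord0 i| <= t.
    move=> hw; apply: le_trans (coord_le_sqrt w i) _.
    rewrite -[leRHS]ger0_norm ?(ltW t0) // -sqrtr_sqr ler_sqrt ?sqr_ge0 //.
    have -> : t ^+ 2 = U / (lam / 2) by rewrite /lam; field; rewrite (lt0r_neq0 U0) (lt0r_neq0 t0).
    have l0 : 0 < lam / 2 by exact: divr_gt0.
    by rewrite ler_pdivlMr // mulrC.
  split; last lra.
  by move=> i; split; apply: bnd; lra.
(* Half of b is t + 2 BK, which bounds the distance from x to any y with [xi y] within t of y. *)
pose b := 2 * t + 4 * BK; have b0 : 0 < b by rewrite /b; lra.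
(* A slope this small changes f + g by at most M/8 over the cube. *)
pose p0 := M / (8 * (N.+1%:R * b)).
have p00 : 0 < p0 by rewrite divr_gt0 // !mulr_gt0.
have fgx : 7 / 8 * M <= f x + g x.
  have := fxi.2 x x Kx; have := get.2 x x Kx; rewrite subrr dot0r mulr0 !subr0 => h1 h2.
  by rewrite /M in udx *; lra.
have pb (p y : 'rV[R]_N) : (forall i, `|p ord0 i| <= p0) -> (forall i, `|(y - x) ord0 i| <= b) ->
   f x + g x + dot p (y - x) <= f y + g y -> 3 / 4 * M <= f y + g y.
  move=> hp hy; have : `|dot p (y - x)| <= M / 8.
    apply: le_trans (ler_norm_sum _ _ _) _; apply: (@le_trans _ _ (N%:R * (p0 * b))).
      by apply: sum_le_const => i; rewrite normrM; apply: ler_pM.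
    have -> : M / 8 = N.+1%:R * (p0 * b).
      by rewrite /p0; field; rewrite ?lt0r_neq0 // pnatr_eq0.
    have pb0 : 0 < p0 * b by exact: mulr_gt0.
    by rewrite (ler_pM2r pb0) ler_nat.
  by rewrite ler_norml; lra.
pose A := N%:R * (lam * (BK + (b + BK)) + lam / 2).
have A0 : 0 <= A by apply: mulr_ge0 => //; apply: addr_ge0; [apply: mulr_ge0|]; lra.
pose rho := Num.min t (Num.min 1 (M / 8 / (A + 1))).
have rho0 : 0 < rho.
  have : 0 < M / 8 / (A + 1) by apply: divr_gt0; lra.
  by rewrite !lt_min t0 ltr01 => ->.
have rhot : rho <= t by rewrite ge_min lexx.
have rho1 : rho <= 1 by rewrite !ge_min lexx orbT.
have rhoA : A * rho <= M / 8.
  have : rho * (A + 1) <= M / 8 by rewrite -ler_pdivlMr ?ge_min ?lexx ?orbT // ltr_wpDl.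
  by rewrite mulrDr mulr1 mulrC; lra.
have [|y [p [z1 [z2 [X [Y [hp [hy hpy] hz [sX sY tX tY] hXY]]]]]]] :=
  touching_pair lam0 b0 p00 (supconv_continuous lam0 fxi hBK) (supconv_continuous lam0 get hBK)
   (supconv_semicvx fxi) (supconv_semicvx get) _ del0 rho0 (c := x).
  move=> p y hp hy h i; have h1 := pb p y hp hy h.
  have fg0 : 0 < f y + g y by lra.
  have [/(_ i)[h2 _] _] := close y y fg0.
  have -> : (y - x) ord0 i = xi y ord0 i - x ord0 i - (xi y - y) ord0 i by rewrite !mxE; lra.
  apply: le_trans (ler_normB _ _) _.
  have h3 := hBK _ (fxi.1 y).1 i; have h4 := hBK _ Kx i.
  have := ler_normB (xi y ord0 i) (x ord0 i); rewrite /b; lra.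
have h34 := pb p y hp hy hpy.
have low (h : 'rV[R]_N -> R) k q z : is_supconv K lam h k q ->
    (forall i, `|(z - y) ord0 i| <= rho) -> k y - M / 8 <= k z.
  move=> hk hzy; have yC i : `|y ord0 i| <= b + BK.
    have -> : y ord0 i = (y - x) ord0 i + x ord0 i by rewrite !mxE subrK.
    by apply: le_trans (ler_normD _ _) _; apply: lerD; [exact: hy | exact: hBK].
  apply: le_trans (supconv_lower lam0 hk hBK yC hzy).
  rewrite lerD2l lerN2; apply: le_trans rhoA; rewrite /A -[leRHS]mulrA ler_wpM2l //.
  rewrite [leRHS]mulrDl lerD2l expr2 mulrA ler_piMr //.
  by apply: mulr_ge0; lra.
have fz1 := low _ _ _ z1 fxi (fun i => (hz i).1).
have gz2 := low _ _ _ z2 get (fun i => (hz i).2).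
have fg2 : M / 2 <= f z1 + g z2 by lra.
have fg20 : 0 < f z1 + g z2 by lra.
have [cl ge] := close z1 z2 fg20.
have [K1 _] := fxi.1 z1; have [K2 _] := get.1 z2.
have uv2 : M / 2 <= u (xi z1) - v (et z2).
  by apply: le_trans fg2 (le_trans ge _); rewrite lerD2r ud_le.
have [i||O1 O2 shift] := hs _ _ K1 K2.
- have -> : (xi z1 - et z2) ord0 i = (xi z1 - z1) ord0 i + (z1 - y) ord0 i - (z2 - y) ord0 i
     - (et z2 - z2) ord0 i by rewrite !mxE; ring.
  have [c1 c2] := cl i; have [c3 c4] := hz i.
  apply: le_trans (ler_normB _ _) _; apply: le_trans (lerD (ler_normB _ _) (lexx _)) _.
  have := ler_normD ((xi z1 - z1) ord0 i) ((z1 - y) ord0 i).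
  by rewrite /t in c1 c2 rhot; lra.
- lra.
have [r1 r10 [l1 H1]] := supconv_touched fxi tX.
have [r2 r20 [l2 H2]] := supconv_touched get tY.
(* Removing del |y|^2 from the touched function lowers the Hessian by 2 del I. *)
have T1 : Th (xi z1) (u (xi z1), X - (2 * del)%:M).
  apply: usub => //; apply: (superjet_quad (l := l1 - (2 * del) *: xi z1) (r := r1)) => //.
    by rewrite linearB /= sX tr_scalar_mx.
  move=> w Ow hw; have := H1 w (subset_closure Ow) hw.
  have -> : w = xi z1 + (w - xi z1) by rewrite addrC subrK.
  rewrite /ud; move: (w - xi z1) => d; rewrite [xi z1 + d - xi z1]addrAC subrr add0r.
  rewrite /quad mulmxBr mul_mx_scalar !(dotDl, dotDr, dotNl, dotZl) (dotC d (xi z1)).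
  lra.
have T2 := shift _ T1.
have J2 : subjet Om v (et z2) (v (et z2), - Y).
  apply: (subjet_quad (l := - l2) (r := r2)) => //; first by rewrite linearN /= sY.
  move=> w Ow hw; have := H2 w (subset_closure Ow) hw.
  by rewrite /quad mulmxN !dotNl; lra.
(* Every q within kap of (v, -Y) dominates the shifted jet [T2]: in values by the gap M/2, in
   Hessians because X + Y <= del I <= 2 (del - kap) I. *)
apply: (vsuper O2 J2); split; first by rewrite /Jsp /symmx /= linearN /= sY.
exists kap => // q sq hq.
have sJ : Jsp (v (et z2), - Y) by rewrite /Jsp /symmx /= linearN /= sY.
have [q1 q2] := jdist_lt sJ sq hq.
apply: Th_order T2 sq _ _ => //=.
  by move: q1 => /=; rewrite ltr_norml; lra.
move=> w; have := q2 w; have := hXY w; rewrite /= !(mulmxDr, mulmxN, mul_mx_scalar).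
rewrite !(dotDl, dotNl, dotZl) ler_norml.
have w0 := dot_ge0 w.
have kw : kap * dot w w <= del / 2 * dot w w by rewrite ler_wpM2r.
lra.
Qed.

End Setting.
End Comparison.

Theorem theorem6p13 (R : realType) (N : nat) (Om : set 'rV[R]_N)
    (F : 'rV[R]_N -> R -> 'M[R]_N -> R)
    (Phi : 'rV[R]_N -> set (R * 'M[R]_N)) :
  bounded_set Om -> open Om -> connected Om ->
  F_continuous Om F ->
  (* constrained case with (v), or unconstrained case with (v') *)
  ((proper_elliptic Om Phi /\ hausdorff_continuous Om Phi /\
    (forall x, Om x ->
       jboundary (Phi x) `<=` [set p | Jsp p /\ F x p.1 p.2 <= 0]))
   \/
   ((forall x, Om x -> Phi x = Jsp (R:=R) (N:=N)) /\
    (forall x, Om x -> exists p, Jsp p /\ F x p.1 p.2 < 0))) ->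
  (* (i) *)
  (forall x p q, Om x -> Phi x p -> Qset q ->
     F x p.1 p.2 <= F x (p.1 + q.1) (p.2 + q.2)) ->
  (* (ii) *)
  (forall Om' : set 'rV[R]_N, open Om' -> compact (closure Om') ->
     closure Om' `<=` Om ->
     forall eta : R, 0 < eta -> exists2 delta : R, 0 < delta &
       forall x y (p : R * 'M[R]_N), Om' x -> Om' y -> eucl_dist x y < delta -> Phi x p ->
         F x p.1 p.2 <= F y (p.1 - eta) (p.2 + eta%:M)) ->
  (* (iii) *)
  (forall x, Om x -> Gamma F x `&` Phi x !=set0) ->
  (* (iv) *)
  (forall x p, Om x -> jinterior (Theta F Phi x) p -> 0 < F x p.1 p.2) ->
  [/\ proper_elliptic Om (Theta F Phi),
      hausdorff_continuous Om (Theta F Phi),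
      (forall x, Om x -> jboundary (Theta F Phi x) `<=` Gamma F x) &
      (forall u v : 'rV[R]_N -> R,
         usc_on (closure Om) u -> lsc_on (closure Om) v ->
         admissible_subsolution Om F Phi u ->
         admissible_supersolution Om F Phi v ->
         (forall x, (closure Om `\` Om) x -> u x <= v x) ->
         forall x, Om x -> u x <= v x)].
Proof.
move=> bO oO _ Fc cs Fm Fs Gn Ti; split.
- exact: Theta_proper.
- exact: Theta_hausdorff.
- exact: Theta_boundary.
move=> u v uu vl [_ us] [_ vs] bd.
apply: (comparison_principle (Th := Theta F Phi) bO oO _ _ uu vl _ _ bd).
- by move=> x p q Ox; apply: (Theta_order cs Fm).
- by move=> x eta Ox; apply: (Theta_shift bO oO cs Fs).
- by move=> x p Ox jp; have [] := us x Ox p jp.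
(* A subjet in the interior of Theta contradicts both alternatives: (iv) gives F > 0, and the
   interior of Theta lies in that of Phi. *)
- move=> x p Ox jp ip; have [Fp|] := vs x Ox p jp; first by have := Ti x p Ox ip; rewrite ltNge Fp.
  by apply; have [sp [e e0 he]] := ip; split=> //; exists e => // q sq /(he q sq)[].
Qed.
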